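(* Let $m,n\ge 0$ be integers and let $P=(x_1,x_2,\dots,x_m,y_1,y_2,\dots,y_n)$ be a pretzel projection of a 2-bouquet, where $x_i=1$ for all $1\le i\le m$ and $y_j\ge 2$ for all $1\le j\le n$. Then the knotting number of $P$ is given as follows. (1) If $n=0$ and $m\in\{0,1\}$, then $kn(P)=\infty$. (2) If $n=0$ and $m>1$, then $kn(P)=\left\lceil \frac{m}{2}\right\rceil+1$. (3) If either $n\ge 1$, all $y_j$ are odd and $m\le n+1$, or $n\ge 1$ and one $y_j$ is even, then $kn(P)=\min\left\{\left\lceil \frac{y_1}{2}\right\rceil+1,\dots,\left\lceil \frac{y_n}{2}\right\rceil+1\right\}$. (4) If $n\ge 1$, all $y_j$ are odd and $m>n+1$, then $kn(P)=\min\left\{\left\lceil \frac{y_1}{2}\right\rceil+1,\dots,\left\lceil \frac{y_n}{2}\right\rceil+1,\left\lceil \frac{m+n}{2}\right\rceil+1\right\}$.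
   Context: A 2-bouquet is a rigid-vertex embedding in $\mathbb{R}^3$ of the graph with one 4-valent vertex and two loops (called petals): the vertex is regarded as a rigid disk with four strands attached in a fixed cyclic order. Two diagrams are equivalent if they are related by finitely many extended Reidemeister moves: RI, RII, RIII (the classical moves), RIV (slide a strand entirely over or entirely under the vertex), and RV (flip the rigid vertex by a half-turn, which transfers a crossing between two adjacent strands on one side of the vertex to a crossing of the same slope type between the two strands on the other side); equivalently, the rigid-vertex graphs are ambient isotopic. A precrossing is a transverse double point without over/under information. A projection is a diagram all of whose double points are precrossings; a pseudodiagram is a diagram whose double points may be crossings or precrossings. Resolving a precrossing means replacing it by a crossing of either type; a resolution of a pseudodiagram is a diagram obtained by resolving all its precrossings. The trivial 2-bouquet of type $K$ is given by the planar diagram without double points, in which each petal leaves and returns to the vertex along two cyclically adjacent strands. The trivial 2-bouquet of type $L$ is given by the diagram with exactly one crossing, in which each petal leaves and returns along two opposite strands and the two petals cross once. A diagram is trivial if it is equivalent to one of these, and nontrivial otherwise. A pseudodiagram is knotted if every resolution of it is nontrivial. The knotting number $kn(Q)$ of a pseudodiagram $Q$ is the minimum number of precrossings that need to be replaced by (suitably chosen) crossings to obtain a knotted pseudodiagram ($\infty$ if this is impossible). Pretzel projection $(x_1,\dots,x_k)$: place $k+1$ disks in a horizontal row. The leftmost disk contains only the 4-valent vertex, with strands leaving at its NW, NE, SW, SE corners. The $i$-th of the remaining disks contains a stack of $x_i$ precrossings placed vertically, i.e. two strands twisted about each other along a vertical axis with $x_i$ double points, with ends at the NW, NE, SW, SE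 corners. For consecutive disks, the NE corner of the left disk is joined to the NW corner of the next, and the SE corner to the SW corner; the NE and SE corners of the last disk are joined around the diagram to the NW and SW corners, respectively, of the vertex disk. Pretzel projections are always assumed to be projections of a 2-bouquet (no additional closed components); in particular at most one entry is even. By convention, the diagram $(1,1,\dots,1)$ with $m$ entries is identified with the single-stack diagram $(m)$; the diagram with no precrossings is $(0)$. *)

(* Defs.v *)
From HB Require Import structures.
From Stdlib Require Import Relation_Operators.
From mathcomp Require Import all_boot.
From mathcomp.classical Require Import boolp.

Set Implicit Arguments.
Unset Strict Implicit.
Unset Printing Implicit Defensive.

(* A pseudodiagram of a 2-bouquet is a connected 4-regular plane graph, given
   by its planar diagram code: a list of nodes, each listing the labels of its
   four edge ends in counterclockwise order, starting anywhere.  As the graph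
   is connected, the code determines the diagram up to isotopy of the sphere;
   moving a strand across the point at infinity is an ambient isotopy, so
   diagrams on the sphere and in the plane have the same equivalence classes.

   In a crossing the strands are legs 0,2 and legs 1,3; [Crossing true] has
   legs 0,2 over, [Crossing false] has legs 1,3 over. *)
Inductive kind := Vertex | Precrossing | Crossing of bool.

Definition kind_eq_dec : comparable kind.
Proof. by rewrite /comparable /decidable; do 2!decide equality. Defined.

HB.instance Definition _ := hasDecEq.Build kind (compareP kind_eq_dec).

Definition node := (kind * 4.-tuple nat)%type.

Definition Node (k : kind) (a b c d : nat) : node := (k, [tuple a; b; c; d]).

Definition pseudodiagram := seq node.

Definition edge_labels (Q : pseudodiagram) : seq nat :=
  flatten [seq val x.2 | x <- Q].

Definition precrossings (Q : pseudodiagram) : nat :=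
  count (fun x => x.1 == Precrossing) Q.

(* The combinatorial map of a pseudodiagram. *)
Definition dart (Q : pseudodiagram) := ('I_(size Q) * 'I_4)%type.

Definition dart_label (Q : pseudodiagram) (d : dart Q) : nat :=
  tnth (tnth (in_tuple Q) d.1).2 d.2.

Definition other_end (Q : pseudodiagram) (d : dart Q) : dart Q :=
  odflt d [pick e | (e != d) && (dart_label e == dart_label d)].

Definition turn (Q : pseudodiagram) (d : dart Q) : dart Q := (d.1, ordS d.2).

(* The orbits of this map are the faces. *)
Definition next_on_face (Q : pseudodiagram) (d : dart Q) : dart Q :=
  turn (other_end d).

(* Euler's formula V + F = E + 2, with E = 2 V by 4-regularity. *)
Definition planar (Q : pseudodiagram) : Prop :=
  size Q + fcard (@next_on_face Q) predT = (size Q).*2 + 2.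

(* The edges met by leaving the vertex and going straight at every double
   point. *)
Inductive on_petal (Q : pseudodiagram) : nat -> Prop :=
| on_petal_vertex x e :
    x \in Q -> x.1 = Vertex -> e \in val x.2 -> on_petal Q e
| on_petal_straight x (j : 'I_4) :
    x \in Q -> x.1 <> Vertex ->
    on_petal Q (tnth x.2 j) -> on_petal Q (tnth x.2 (ordS (ordS j))).

(* The last condition excludes additional closed components, and makes the
   graph connected. *)
Definition two_bouquet (Q : pseudodiagram) : Prop :=
  [/\ forall e, e \in edge_labels Q -> count_mem e (edge_labels Q) = 2,
      count (fun x => x.1 == Vertex) Q = 1,
      planar Q &
      forall e, e \in edge_labels Q -> on_petal Q e].

Definition relabel (f : nat -> nat) (Q : pseudodiagram) : pseudodiagram :=
  [seq (x.1, map_tuple f x.2) | x <- Q].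

Definition rename (b a e : nat) : nat := if e == b then a else e.

Definition rotate (x : node) : node :=
  (if x.1 is Crossing o then Crossing (~~ o) else x.1, [tuple of rot 1 x.2]).

(* Changes of code that do not change the diagram. *)
Inductive same_diagram : pseudodiagram -> pseudodiagram -> Prop :=
| same_perm Q Q' : perm_eq Q Q' -> same_diagram Q Q'
| same_rotate x Q : same_diagram (x :: Q) (rotate x :: Q)
| same_relabel f Q :
    {in edge_labels Q &, injective f} -> same_diagram Q (relabel f Q).

(* The moves, each in one direction.  In the last three, the same names are
   used for the inner edges before and after the move.

   RI: the kink a - e - b becomes an arc.

   RII: the strands a - m - a' and b - n - b' bound a bigon with sides m and
   n, and one is over the other at both ends.  Both get joined; if a' and b,
   say, are the same edge, the second join must refer to its new name.

   RIII and RIV: the strand s - t passes from below to above a node with outer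
   ends NE, NW, SW, SE at [ne], [nw], [sw], [se]; it is over at both crossings
   when [o] is true and under when [o] is false.  Every triangle allowing RIII
   has a strand that is over the other two.

   RV: before the move, a crossing lies to the right of the vertex, with outer
   ends [ne], [se]; after a half-turn of the vertex about the horizontal axis
   it lies to the left, with outer ends [nw], [sw].  The over-strand has
   positive slope when [o] is true, and negative slope when [o] is false. *)
Inductive reidemeister : pseudodiagram -> pseudodiagram -> Prop :=
| RI o e a b D :
    reidemeister (Node (Crossing o) e e a b :: D) (relabel (rename b a) D)
| RII o a m a' b n b' D :
    let r := rename a' a in
    reidemeister
      (Node (Crossing o) n a b m :: Node (Crossing (~~ o)) a' n m b' :: D)
      (relabel (rename (r b') (r b) \o r) D)
| RIII o o' ne nw sw se s t p q m D :
    reidemeister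
      [:: Node (Crossing o') ne nw p q,
          Node (Crossing o) m p s sw,
          Node (Crossing o) t q m se & D]
      [:: Node (Crossing o') q p sw se,
          Node (Crossing o) m nw s p,
          Node (Crossing o) t ne m q & D]
| RIV o ne nw sw se s t p q m D :
    reidemeister
      [:: Node Vertex ne nw p q,
          Node (Crossing o) m p s sw,
          Node (Crossing o) t q m se & D]
      [:: Node Vertex q p sw se,
          Node (Crossing o) m nw s p,
          Node (Crossing o) t ne m q & D]
| RV o ne nw sw se p q D :
    reidemeister
      [:: Node Vertex p nw sw q, Node (Crossing o) ne p q se & D]
      [:: Node Vertex ne p q se, Node (Crossing o) p nw sw q & D].

Definition move (D D' : pseudodiagram) : Prop :=
  same_diagram D D' \/ reidemeister D D'.

(* From a 2-bouquet diagram, moves in the forward direction lead to 2-bouquet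
   diagrams.  A backward move is a move of diagrams exactly when its result is
   one; without this requirement a backward RII could break planarity.  Hence
   [equivalent] is an equivalence relation on 2-bouquet diagrams. *)
Definition step (D D' : pseudodiagram) : Prop :=
  move D D' \/ two_bouquet D' /\ move D' D.

Definition equivalent : pseudodiagram -> pseudodiagram -> Prop :=
  clos_refl_trans pseudodiagram step.

Definition trivial_K : pseudodiagram := [:: Node Vertex 0 0 1 1].

(* The other choice of crossing gives the same diagram, by a quarter-turn of
   the vertex. *)
Definition trivial_L : pseudodiagram :=
  [:: Node Vertex 0 1 2 3; Node (Crossing true) 3 2 1 0].

Definition trivial_diagram (D : pseudodiagram) : Prop :=
  equivalent D trivial_K \/ equivalent D trivial_L.

(* [refines Q Q']: Q' is obtained from Q by replacing some precrossings by
   crossings. *)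
Definition refines (Q Q' : pseudodiagram) : bool :=
  all2 (fun x x' : node =>
    (x'.2 == x.2) &&
    ((x'.1 == x.1) || (x.1 == Precrossing) && (x'.1 != Vertex))) Q Q'.

Definition resolution (Q D : pseudodiagram) : Prop :=
  refines Q D /\ precrossings D = 0.

Definition knotted (Q : pseudodiagram) : Prop :=
  forall D, resolution Q D -> ~ trivial_diagram D.

Definition knotted_by (Q : pseudodiagram) (k : nat) : Prop :=
  exists Q', [/\ refines Q Q', precrossings Q = precrossings Q' + k & knotted Q'].

(* The least k with [knotted_by Q k], where [None] stands for infinity. *)
Definition knotting_number (Q : pseudodiagram) : option nat :=
  ohead [seq k <- iota 0 (precrossings Q).+1 | `[< knotted_by Q k >]].

(* A stack of x >= 1 precrossings with top ends l, r and bottom ends l', r';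
   the inner edges are f, f + 1, ..., f + 2 x - 3. *)
Fixpoint stack (l r l' r' x f : nat) : pseudodiagram :=
  match x with
  | 0 => [::]
  | 1 => [:: Node Precrossing r l l' r']
  | x'.+1 => Node Precrossing r l f f.+1 :: stack f f.+1 l' r' x' f.+2
  end.

(* Column i has corners NW, NE, SW, SE on the edges 2i, 2i + 2, 2i + 1,
   2i + 3. *)
Fixpoint columns (i f : nat) (xs : seq nat) : pseudodiagram :=
  if xs is x :: xs' then
    stack i.*2 i.+1.*2 i.*2.+1 i.+1.*2.+1 x f ++ columns i.+1 (f + x.*2) xs'
  else [::].

(* The pretzel projection with positive entries xs: the vertex has its corners
   NE and SE on the edges 0 and 1, and its corners NW and SW on the edges that
   leave the last column. *)
Definition pretzel (xs : seq nat) : pseudodiagram :=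
  let k := size xs in
  Node Vertex 0 k.*2 k.*2.+1 1 :: columns 0 k.*2.+2 xs.

(* Main.v *)
(* The vertex slopes of Fox colourings decide which resolutions are trivial.
   Colour the edges by elements of a commutative ring so that at every crossing
   the over-strand keeps its colour and the sum of the two under-colours is
   twice the over-colour, and so that the colours a, b, c, d around the vertex
   satisfy a + c = b + d.  The moves preserve these colourings, and the pair
   (a - d, a - b) up to quarter-turns.  A stack with net twist w adds w (r - l)
   to the colours l, r of its top ends, so in a pretzel diagram all the products
   w_j d_j, with d_j the horizontal difference across column j, equal the
   vertical difference at the vertex, whose horizontal difference is the sum of
   the d_j.  Over Z, trivial diagrams have a colouring with slope 0, infinity, 1
   or -1 and entries of absolute value at most 1; this fails as soon as all w_j
   are nonzero and some |w_j| >= 2 or |w_1 + ... + w_k| >= 2 with all |w_j| = 1.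
   If some w_j = 0 and |w_i| = r >= 2, there is a nonconstant colouring in Z/r
   that is constant at the vertex, which no trivial diagram has.

   Conversely, if too few crossings are fixed, then either all columns can be
   resolved to w_j = 1 or -1 with total 0, 1 or -1, or the even column can be
   resolved to 0 and the others to 1 or -1; both cases simplify to a trivial
   diagram by RII and RI. *)
Require Import Defs.
From Stdlib Require Import Relation_Operators.
From mathcomp Require Import all_boot.
From mathcomp Require Import order ssralg ssrnum ssrint zmodp.
From mathcomp.classical Require Import boolp.
From mathcomp Require Import zify ring.

Set Implicit Arguments.
Unset Strict Implicit.
Unset Printing Implicit Defensive.

Import Order.TTheory GRing.Theory Num.Theory.


(** * Nodes and edge labels *)

Lemma node_expand (x : node) : exists k a b c d, x = Node k a b c d.
Proof.
case: x => k t; case/tupleP: t => a t; case/tupleP: t => b t.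
case/tupleP: t => c t; case/tupleP: t => d t; rewrite (tuple0 t).
by exists k, a, b, c, d; congr pair; apply: val_inj.
Qed.

Definition relabel_node (f : nat -> nat) (x : node) : node :=
  (x.1, map_tuple f x.2).

Lemma relabel_Node f k a b c d :
  relabel_node f (Node k a b c d) = Node k (f a) (f b) (f c) (f d).
Proof. by congr pair; apply: val_inj. Qed.

Definition turn_kind (k : kind) : kind :=
  if k is Crossing o then Crossing (~~ o) else k.

Lemma rotate_Node k a b c d :
  rotate (Node k a b c d) = Node (turn_kind k) b c d a.
Proof. by congr pair; apply: val_inj. Qed.

Lemma edge_labels_cons x Q : edge_labels (x :: Q) = val x.2 ++ edge_labels Q.
Proof. by []. Qed.

Lemma edge_labels_relabel f Q :
  edge_labels (relabel f Q) = map f (edge_labels Q).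
Proof. by elim: Q => //= x Q IH; rewrite edge_labels_cons map_cat -IH. Qed.

(** The label condition of [two_bouquet] in a form that speaks of every natural number, so that it
    passes to a list from which both ends of an edge have been removed. *)
Definition paired (L : seq nat) : Prop :=
  forall e : nat, count_mem e L = 0 \/ count_mem e L = 2.

Definition has_vertex (Q : pseudodiagram) : bool :=
  has (fun x : node => x.1 == Vertex) Q.

(** * Fox colourings with a condition at the vertex *)

Local Open Scope ring_scope.

(** [S] restricts the pair of differences at the vertex. At a precrossing both strands keep their
    colour; over Z/2 this agrees with the rule at a crossing, so that refinements can be
    compared. *)
Definition node_rule (A : comNzRingType) (S : A -> A -> Prop) (k : kind)
    (a b c d : A) : Prop :=
  match k with
  | Vertex => a + c = b + d /\ S (a - d) (a - b)
  | Precrossing => a = c /\ b = d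
  | Crossing true => a = c /\ a + c = b + d
  | Crossing false => b = d /\ a + c = b + d
  end.

Definition colored_node (A : comNzRingType) (S : A -> A -> Prop) (c : nat -> A)
    (x : node) : Prop :=
  let leg i := c (nth 0%N x.2 i) in node_rule S x.1 (leg 0%N) (leg 1%N) (leg 2) (leg 3).

Definition coloring (A : comNzRingType) (S : A -> A -> Prop) (c : nat -> A)
    (Q : pseudodiagram) : Prop :=
  forall x, x \in Q -> colored_node S c x.

Definition monochromatic (A : comNzRingType) (c : nat -> A) (Q : pseudodiagram) :=
  exists K, forall e, e \in edge_labels Q -> c e = K.

Definition colorable (A : comNzRingType) (S : A -> A -> Prop)
    (Q : pseudodiagram) : Prop :=
  exists2 c : nat -> A, coloring S c Q & ~ monochromatic c Q.

(** Starting the code [a b c d] of the vertex at the next leg turns the pair [(a - d, a - b)] into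
    [(b - a, b - c)], and [b - c = a - d] by the sum rule. *)
Definition turn_invariant (A : comNzRingType) (S : A -> A -> Prop) : Prop :=
  forall u v, S u v -> S (- v) u.

(** Together with the sum rule, this makes the colouring constant at the vertex. *)
Definition flat (A : comNzRingType) (u v : A) : Prop := u = 0 /\ v = 0.

Lemma flat_turn (A : comNzRingType) : turn_invariant (@flat A).
Proof. by move=> u v [-> ->]; rewrite /flat oppr0. Qed.

Lemma coloring_cons (A : comNzRingType) (S : A -> A -> Prop) c x Q :
  coloring S c (x :: Q) <-> colored_node S c x /\ coloring S c Q.
Proof.
split=> [H|[Hx HQ] z]; last by rewrite inE => /predU1P[->|/HQ].
by split=> [|z Hz]; apply: H; rewrite inE ?eqxx ?Hz ?orbT.
Qed.

Lemma coloring_cat (A : comNzRingType) (S : A -> A -> Prop) c Q Q' :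
  coloring S c (Q ++ Q') <-> coloring S c Q /\ coloring S c Q'.
Proof.
elim: Q => [|x Q IH] /=; first by split=> [|[]].
by rewrite !coloring_cons IH; split=> [[?[]]|[[]]].
Qed.

Lemma coloring_perm (A : comNzRingType) (S : A -> A -> Prop) c Q Q' :
  perm_eq Q Q' -> coloring S c Q -> coloring S c Q'.
Proof. by move=> pQ H x; rewrite -(perm_mem pQ); apply: H. Qed.

Lemma coloring_relabel (A : comNzRingType) (S : A -> A -> Prop) c f Q :
  coloring S c (relabel f Q) <-> coloring S (c \o f) Q.
Proof.
have E x : colored_node S c (relabel_node f x) <-> colored_node S (c \o f) x.
  by have [k [a1 [a2 [a3 [a4 ->]]]]] := node_expand x; rewrite relabel_Node.
split=> H x => [xQ|/mapP[z zQ ->]]; apply/E; last exact: H.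
by apply: H; apply/mapP; exists x.
Qed.

Lemma edge_labels_sub x Q : x \in Q -> {subset val x.2 <= edge_labels Q}.
Proof. by move=> xQ e ex; apply/flatten_mapP; exists x. Qed.

Lemma eq_coloring (A : comNzRingType) (S : A -> A -> Prop) c c' Q :
  {in edge_labels Q, c =1 c'} -> coloring S c Q -> coloring S c' Q.
Proof.
move=> E H x xQ; have := H x xQ; have := edge_labels_sub xQ.
have [k [a1 [a2 [a3 [a4 ->]]]]] := node_expand x; rewrite /colored_node /= => L.
by rewrite !E //; apply: L; rewrite !inE eqxx ?orbT.
Qed.

Lemma monochromatic_relabel (A : comNzRingType) (c : nat -> A) f Q :
  monochromatic c (relabel f Q) <-> monochromatic (c \o f) Q.
Proof.
split=> -[K H]; exists K => e; rewrite ?edge_labels_relabel.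
  by move=> eQ; apply: H; rewrite edge_labels_relabel map_f.
by case/mapP=> z zQ ->; apply: H.
Qed.

Lemma eq_monochromatic (A : comNzRingType) (c c' : nat -> A) Q :
  {in edge_labels Q, c =1 c'} -> monochromatic c Q -> monochromatic c' Q.
Proof. by move=> E [K H]; exists K => e eQ; rewrite -E // H. Qed.

Lemma perm_edge_labels Q Q' :
  perm_eq Q Q' -> perm_eq (edge_labels Q) (edge_labels Q').
Proof. by move=> pQ; apply/perm_flatten/perm_map. Qed.

Lemma perm_monochromatic (A : comNzRingType) (c : nat -> A) Q Q' :
  edge_labels Q' =i edge_labels Q -> monochromatic c Q -> monochromatic c Q'.
Proof. by move=> pQ [K H]; exists K => e; rewrite pQ; apply: H. Qed.

Lemma node_rule_turn (A : comNzRingType) (S : A -> A -> Prop) k a b c d :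
  turn_invariant S ->
  node_rule S k a b c d -> node_rule S (turn_kind k) b c d a.
Proof.
move=> turnS; case: k => [||[]] /= [H1 H2]; last first.
- by split; last rewrite -H2 addrC.
- by split; last rewrite -H2 addrC.
- by [].
split; first by rewrite -H1 addrC.
have -> : b - a = - (a - b) by ring.
have -> : b - c = a - d; last exact: turnS.
have -> : c = b + d - a by rewrite -H1; ring.
ring.
Qed.

(** The map [x -> 2 s - x] is affine, so it respects the linear rules; at the vertex it negates both
    differences, which amounts to two quarter-turns. *)
Lemma node_rule_reflect (A : comNzRingType) (S : A -> A -> Prop) k s a b c d :
  turn_invariant S -> node_rule S k a b c d ->
  node_rule S k (s + s - a) (s + s - b) (s + s - c) (s + s - d).
Proof.
move=> turnS.
have E : a + c = b + d -> s + s - a + (s + s - c) = s + s - b + (s + s - d).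
  move=> H; have -> : a = b + d - c by rewrite -H; ring.
  ring.
case: k => [||[]] /= [H1 H2].
- split; first exact: E.
  have -> : s + s - a - (s + s - d) = - (a - d) by ring.
  have -> : s + s - a - (s + s - b) = - (a - b) by ring.
  exact: turnS (turnS _ _ H2).
- by rewrite H1 H2.
- by split; [rewrite H1 | apply: E].
- by split; [rewrite H1 | apply: E].
Qed.

Lemma node_rule_sum (A : comNzRingType) (S : A -> A -> Prop) k a b c d :
  node_rule S k a b c d -> a + c = b + d \/ k = Precrossing.
Proof. by case: k => [||[]] /= []; auto. Qed.

(** * Invariance of colourings under the moves *)

Definition recolor (A : Type) (c : nat -> A) (new : seq (nat * A)) (e : nat) : A :=
  foldr (fun u v => if u.1 == e then u.2 else v) (c e) new.

Lemma recolor_out (A : Type) (c : nat -> A) new e :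
  e \notin unzip1 new -> recolor c new e = c e.
Proof.
rewrite /recolor; elim: new => //= u new IH.
by rewrite inE eq_sym negb_or => /andP[/negPf-> /IH].
Qed.

Lemma coloring_recolor (A : comNzRingType) (S : A -> A -> Prop) c new Q :
  all (fun e => e \notin edge_labels Q) (unzip1 new) ->
  coloring S c Q -> coloring S (recolor c new) Q.
Proof.
move=> fresh; apply: eq_coloring => e eQ; rewrite recolor_out //.
by apply/negP => /(allP fresh); rewrite eQ.
Qed.

(** The two displayed occurrences exhaust the count of [e]. *)
Lemma paired_fresh L0 e L :
  paired L0 -> perm_eq L0 [:: e, e & L] -> e \notin L.
Proof.
by move=> + pQ => /(_ e); rewrite (permP pQ) /= eqxx => -[|[]]// /count_memPn.
Qed.

Ltac fresh_facts :=
  rewrite ?inE ?mem_cat ?inE ?negb_or;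
  repeat (case/andP => /negPf ?).

Ltac fresh_simpl :=
  repeat match goal with
  | H : (?x == ?y) = false |- context [?x == ?y] => rewrite H
  | H : (?x == ?y) = false |- context [?y == ?x] => rewrite (eq_sym y x) H
  end; rewrite ?eqxx.

(** Two lists with the same count for every predicate are permutations of each other, and the counts
    are sums that [ring] compares. *)
Ltac label_perm := apply/permP => P; rewrite /edge_labels /=; ring.

(** One shape for RIII and RIV: [k] is the kind of the node that the strand passes. *)
Definition slide_under (k : kind) o ne nw sw se s t p q m D : pseudodiagram :=
  [:: Node k ne nw p q, Node (Crossing o) m p s sw, Node (Crossing o) t q m se & D].

Definition slide_above (k : kind) o ne nw sw se s t p q m D : pseudodiagram :=
  [:: Node k q p sw se, Node (Crossing o) m nw s p, Node (Crossing o) t ne m q & D].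

Lemma slide_labels k o ne nw sw se s t p q m D :
  perm_eq (edge_labels (slide_under k o ne nw sw se s t p q m D))
          (edge_labels (slide_above k o ne nw sw se s t p q m D)).
Proof. label_perm. Qed.

Lemma slide_fresh k o ne nw sw se s t p q m D :
  paired (edge_labels (slide_under k o ne nw sw se s t p q m D)) ->
  [/\ p \notin [:: q; m; ne; nw; sw; se; s; t] ++ edge_labels D,
      q \notin [:: m; ne; nw; sw; se; s; t] ++ edge_labels D &
      m \notin [:: ne; nw; sw; se; s; t] ++ edge_labels D].
Proof.
move=> pairD.
have Fp : p \notin [:: q; q; m; m; ne; nw; sw; se; s; t] ++ edge_labels D.
  by apply: paired_fresh pairD _; label_perm.
have Fq : q \notin [:: p; p; m; m; ne; nw; sw; se; s; t] ++ edge_labels D.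
  by apply: paired_fresh pairD _; label_perm.
have Fm : m \notin [:: p; p; q; q; ne; nw; sw; se; s; t] ++ edge_labels D.
  by apply: paired_fresh pairD _; label_perm.
split; [move: Fp | move: Fq | move: Fm];
  by rewrite !mem_cat !inE; do ?[case: (_ == _) => //=].
Qed.

(* When the strand s - t is over, it reflects the colours of the node that it
   passes in the colour of s; when it is under, it keeps them. *)
Lemma slide_colorable (A : comNzRingType) (S : A -> A -> Prop) k o ne nw sw se s t p q m D :
  turn_invariant S -> k != Precrossing ->
  paired (edge_labels (slide_under k o ne nw sw se s t p q m D)) ->
  colorable S (slide_under k o ne nw sw se s t p q m D) <->
  colorable S (slide_above k o ne nw sw se s t p q m D).
Proof.
move=> turnS kP pairD.
have memL := perm_mem (slide_labels k o ne nw sw se s t p q m D).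
have [+ + +] := slide_fresh pairD; do 3![fresh_facts; move=> ?].
have fresh (a b d : A) :
    all (fun e => e \notin edge_labels D) (unzip1 [:: (p, a); (q, b); (m, d)]).
  by rewrite /=; apply/and4P.
split=> -[c]; rewrite /slide_under /slide_above !coloring_cons /colored_node /=.
- move=> -[H1 [H2 [H3 HD]]] nmono.
  (* The outer edges keep their colours; the two new crossings then force the colours of [p], [q]
     and [m]. *)
  have [c' Ec'] : exists c', c' = recolor c [:: (p, if o then c s + c s - c nw else c nw);
     (q, if o then c s + c s - c ne else c ne);
     (m, if o then c s else c nw + c nw - c s)] by eexists.
  exists c'.
    rewrite !coloring_cons; split; [|split; [|split]];
      last by rewrite Ec'; apply: coloring_recolor HD.
    + rewrite /colored_node Ec' /recolor /=; fresh_simpl; case: (o) H2 H3 => /= -[E1 E2] [E3 E4].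
        have -> : c sw = c s + c s - c p by rewrite -{1}E1 E2; ring.
        have -> : c se = c s + c s - c q by rewrite -E1 -{1}E3 E4; ring.
        exact: node_rule_reflect.
      by rewrite -E1 -E3.
    + rewrite /colored_node Ec' /recolor /=; fresh_simpl.
      by case: (o) H2 H3 => /= _ _; split=> //; ring.
    + rewrite /colored_node Ec' /recolor /=; fresh_simpl; case: (o) H2 H3 => /= -[E1 E2] [E3 E4].
        by split; [rewrite E3 E1 | rewrite E3 E1; ring].
      split=> //; rewrite -E3 -E1 in E2 E4.
      (* For a strand passing under, the colours of [s] and [t] fit on the new side because opposite
         legs of the passed node have equal sums. *)
      have [E|/eqP E] := node_rule_sum H1; last by rewrite E in kP.
      have -> : c t = c q + c q - c m by rewrite -E4; ring.
      have -> : c m = c p + c p - c s by rewrite -E2; ring.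
      have -> : c ne = c nw + c q - c p by rewrite -E; ring.
      ring.
  (* If the new colouring is constant, so is the old one on the outer edges, and the old crossings
     force the same colour on [p], [q] and [m]. *)
  apply: contra_not nmono => -[K HK]; exists K.
  have Kouter e : e \in [:: ne; nw; s; sw; t; se] -> c e = K.
    move=> He; rewrite -(HK e); last first.
      rewrite -memL /edge_labels /= !inE.
      by move: He; rewrite !inE; do 5?case/predU1P=> [->|]; last move=> /eqP->; rewrite ?eqxx ?orbT.
    rewrite Ec'; apply/esym/recolor_out; move: He; rewrite /= !inE.
    by do 5?case/predU1P=> [->|]; last move=> /eqP->; fresh_simpl.
  have [Ks Ksw Kse] : [/\ c s = K, c sw = K & c se = K].
    by split; apply: Kouter; rewrite !inE eqxx ?orbT.
  have [Kp Kq Km] : [/\ c p = K, c q = K & c m = K].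
    case: (o) H2 H3 => /= -[E1 E2] [E3 E4]; rewrite ?Ks ?Ksw ?Kse in E1 E2 E3 E4.
      rewrite E3 E1 in E4; rewrite E1 in E2.
      by split=> //; [apply/esym/(addIr K) | apply/esym/(addIr K)].
    by rewrite E1 in E2; split=> //; apply/(addIr K).
  move=> e He; case: (eqVneq e p) => [->|ep] //; case: (eqVneq e q) => [->|eq] //.
  case: (eqVneq e m) => [->|em] //; rewrite -(HK e) -?memL // Ec' recolor_out //=.
  by rewrite !inE !negb_or ep eq em.
- move=> -[H1 [H2 [H3 HD]]] nmono.
  have [c' Ec'] : exists c', c' = recolor c [:: (p, if o then c s + c s - c sw else c sw);
     (q, if o then c s + c s - c se else c se); (m, if o then c s else c sw + c sw - c s)].
    by eexists.
  exists c'.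
    rewrite !coloring_cons; split; [|split; [|split]];
      last by rewrite Ec'; apply: coloring_recolor HD.
    + rewrite /colored_node Ec' /recolor /=; fresh_simpl.
      case: (o) H2 H3 => /= -[E1 E2] [E3 E4].
        have -> : c ne = c s + c s - c q by rewrite -E1 -{1}E3 E4; ring.
        have -> : c nw = c s + c s - c p by rewrite -{1}E1 E2; ring.
        exact: node_rule_reflect.
      by rewrite E1 E3.
    + rewrite /colored_node Ec' /recolor /=; fresh_simpl.
      by case: (o) H2 H3 => /= _ _; split=> //; ring.
    + rewrite /colored_node Ec' /recolor /=; fresh_simpl.
      case: (o) H2 H3 => /= -[E1 E2] [E3 E4].
        by split; [rewrite E3 E1 | rewrite E3 E1; ring].
      split=> //; rewrite -E3 -E1 in E2 E4.
      have [E|/eqP E] := node_rule_sum H1; last by rewrite E in kP.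
      rewrite -E1 -E3 in E.
      have -> : c t = c ne + c ne - c m by rewrite -E4; ring.
      have -> : c m = c nw + c nw - c s by rewrite -E2; ring.
      have -> : c ne = c nw + c se - c sw by rewrite -E; ring.
      ring.
  apply: contra_not nmono => -[K HK]; exists K.
  have Kouter e : e \in [:: ne; nw; s; sw; t; se] -> c e = K.
    move=> He; rewrite -(HK e); last first.
      rewrite memL /edge_labels /= !inE.
      by move: He; rewrite !inE; do 5?case/predU1P=> [->|]; last move=> /eqP->; rewrite ?eqxx ?orbT.
    rewrite Ec'; apply/esym/recolor_out; move: He; rewrite /= !inE.
    by do 5?case/predU1P=> [->|]; last move=> /eqP->; fresh_simpl.
  have [Ks Knw Kne] : [/\ c s = K, c nw = K & c ne = K].
    by split; apply: Kouter; rewrite !inE eqxx ?orbT.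
  have [Kp Kq Km] : [/\ c p = K, c q = K & c m = K].
    case: (o) H2 H3 => /= -[E1 E2] [E3 E4]; rewrite ?Ks ?Knw ?Kne in E1 E2 E3 E4.
      rewrite E3 E1 in E4; rewrite E1 in E2.
      by split=> //; [apply/esym/(addrI K) | apply/esym/(addrI K)].
    by rewrite -E1 in E2; split=> //; apply/(addIr K).
  move=> e He; case: (eqVneq e p) => [->|ep] //; case: (eqVneq e q) => [->|eq] //.
  case: (eqVneq e m) => [->|em] //; rewrite -(HK e) ?memL // Ec' recolor_out //=.
  by rewrite !inE !negb_or ep eq em.
Qed.

Definition flip_right o ne nw sw se p q D : pseudodiagram :=
  [:: Node Vertex p nw sw q, Node (Crossing o) ne p q se & D].

Definition flip_left o ne nw sw se p q D : pseudodiagram :=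
  [:: Node Vertex ne p q se, Node (Crossing o) p nw sw q & D].

Lemma flip_labels o ne nw sw se p q D :
  perm_eq (edge_labels (flip_right o ne nw sw se p q D))
          (edge_labels (flip_left o ne nw sw se p q D)).
Proof. label_perm. Qed.

Lemma flip_fresh o ne nw sw se p q D :
  paired (edge_labels (flip_right o ne nw sw se p q D)) ->
  p \notin [:: q; ne; nw; sw; se] ++ edge_labels D /\
  q \notin [:: ne; nw; sw; se] ++ edge_labels D.
Proof.
move=> pairD.
have Fp : p \notin [:: q; q; ne; nw; sw; se] ++ edge_labels D.
  by apply: paired_fresh pairD _; label_perm.
have Fq : q \notin [:: p; p; ne; nw; sw; se] ++ edge_labels D.
  by apply: paired_fresh pairD _; label_perm.
split; [move: Fp | move: Fq];
  by rewrite !mem_cat !inE; do ?[case: (_ == _) => //=].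
Qed.

(** The colours of the outer edges are kept, and those of [p] and [q] are forced by the crossing in
    its new place. The pair of differences at the vertex turns out to be the same on both sides. *)
Lemma flip_colorable (A : comNzRingType) (S : A -> A -> Prop) o ne nw sw se p q D :
  paired (edge_labels (flip_right o ne nw sw se p q D)) ->
  colorable S (flip_right o ne nw sw se p q D) <->
  colorable S (flip_left o ne nw sw se p q D).
Proof.
move=> pairD.
have memL := perm_mem (flip_labels o ne nw sw se p q D).
have [+ +] := flip_fresh pairD; do 2![fresh_facts; move=> ?].
have fresh (a b : A) :
    all (fun e => e \notin edge_labels D) (unzip1 [:: (p, a); (q, b)]).
  by rewrite /=; apply/and3P.
split=> -[c]; rewrite /flip_right /flip_left !coloring_cons /colored_node /=.
- move=> -[[H1 HS] [H2 HD]] nmono.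
  have [c' Ec'] : exists c', c' = recolor c
      [:: (p, if o then c sw else c nw + c nw - c sw);
          (q, if o then c sw + c sw - c nw else c nw)] by eexists.
  exists c'.
    rewrite !coloring_cons; split; [|split];
      last by rewrite Ec'; apply: coloring_recolor HD.
    + rewrite /colored_node Ec' /recolor /=; fresh_simpl.
      case: (o) H2 => /= -[E1 E2].
        have Ep : c p = c nw + c q - c sw by rewrite -H1; ring.
        have Ese : c se = c ne + c sw - c nw.
          have -> : c se = c ne + c q - c p by rewrite E2; ring.
          by rewrite Ep E1; ring.
        split; first by rewrite Ese; ring.
        suff [<- <-] : c p - c q = c ne - c se /\ c p - c nw = c ne - c sw by [].
        by rewrite Ep Ese E1; split; ring.
      have Eq : c q = c p + c sw - c nw by rewrite H1; ring.
      have Ene : c ne = c se + c nw - c sw.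
        have -> : c ne = c p + c se - c q by rewrite -E2; ring.
        by rewrite Eq E1; ring.
      split; first by rewrite Ene; ring.
      suff [<- <-] : c p - c q = c ne - c se /\
                     c p - c nw = c ne - (c nw + c nw - c sw) by [].
      by rewrite Eq Ene E1; split; ring.
    + rewrite /colored_node Ec' /recolor /=; fresh_simpl.
      by case: (o) H2 => /= _; split=> //; ring.
  apply: contra_not nmono => -[K HK]; exists K.
  have Kouter e : e \in [:: ne; nw; sw; se] -> c e = K.
    move=> He; rewrite -(HK e); last first.
      rewrite -memL /edge_labels /= !inE.
      by move: He; rewrite !inE; do 3?case/predU1P=> [->|]; last move=> /eqP->; rewrite ?eqxx ?orbT.
    rewrite Ec'; apply/esym/recolor_out; move: He; rewrite /= !inE.
    by do 3?case/predU1P=> [->|]; last move=> /eqP->; fresh_simpl.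
  have [Kne Kse] : c ne = K /\ c se = K.
    by split; apply: Kouter; rewrite !inE eqxx ?orbT.
  have [Kp Kq] : c p = K /\ c q = K.
    case: (o) H2 => /= -[E1 E2]; rewrite ?Kne ?Kse in E1 E2.
      by rewrite -E1 in E2; split=> //; apply/esym/(addIr K).
    by rewrite E1 in E2; split=> //; apply/(addrI K).
  move=> e He; case: (eqVneq e p) => [->|ep] //; case: (eqVneq e q) => [->|eq] //.
  rewrite -(HK e) -?memL // Ec' recolor_out //=.
  by rewrite !inE !negb_or ep eq.
- move=> -[[H1 HS] [H2 HD]] nmono.
  have [c' Ec'] : exists c', c' = recolor c
      [:: (p, if o then c ne + c ne - c se else c se);
          (q, if o then c ne else c se + c se - c ne)] by eexists.
  exists c'.
    rewrite !coloring_cons; split; [|split];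
      last by rewrite Ec'; apply: coloring_recolor HD.
    + rewrite /colored_node Ec' /recolor /=; fresh_simpl.
      case: (o) H2 => /= -[E1 E2].
        have Eq : c q = c sw + c sw - c nw by rewrite -{1}E1 E2; ring.
        have Ene : c ne = c p + c se - c q by rewrite -H1; ring.
        split; first by rewrite Ene Eq E1; ring.
        suff [<- <-] : c ne - c se = c ne + c ne - c se - c ne /\
            c ne - c p = c ne + c ne - c se - c nw by [].
        by rewrite Ene Eq E1; split; ring.
      have Ep : c p = c nw + c nw - c sw by rewrite {2}E1 -E2; ring.
      have Ese : c se = c ne + c q - c p by rewrite H1; ring.
      split; first by rewrite Ese Ep -E1; ring.
      suff [<- <-] : c ne - c se = c se - (c se + c se - c ne) /\
          c ne - c p = c se - c nw by [].
      by rewrite Ese Ep -E1; split; ring.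
    + rewrite /colored_node Ec' /recolor /=; fresh_simpl.
      by case: (o) H2 => /= _; split=> //; ring.
  apply: contra_not nmono => -[K HK]; exists K.
  have Kouter e : e \in [:: ne; nw; sw; se] -> c e = K.
    move=> He; rewrite -(HK e); last first.
      rewrite memL /edge_labels /= !inE.
      by move: He; rewrite !inE; do 3?case/predU1P=> [->|]; last move=> /eqP->; rewrite ?eqxx ?orbT.
    rewrite Ec'; apply/esym/recolor_out; move: He; rewrite /= !inE.
    by do 3?case/predU1P=> [->|]; last move=> /eqP->; fresh_simpl.
  have [Knw Ksw] : c nw = K /\ c sw = K.
    by split; apply: Kouter; rewrite !inE eqxx ?orbT.
  have [Kp Kq] : c p = K /\ c q = K.
    case: (o) H2 => /= -[E1 E2]; rewrite ?Knw ?Ksw in E1 E2.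
      by rewrite E1 in E2; split=> //; apply/esym/(addrI K).
    by rewrite -E1 in E2; split=> //; apply/(addIr K).
  move=> e He; case: (eqVneq e p) => [->|ep] //; case: (eqVneq e q) => [->|eq] //.
  rewrite -(HK e) ?memL // Ec' recolor_out //=.
  by rewrite !inE !negb_or ep eq.
Qed.

(** * Joining two edges into one *)

Lemma paired_perm L L' : perm_eq L L' -> paired L -> paired L'.
Proof. by move=> pL H e; rewrite -(permP pL); apply: H. Qed.

Lemma paired_behead2 e L : paired [:: e, e & L] -> paired L.
Proof. by move=> H x; have /= := H x; case: (e == x); lia. Qed.

(** If [a] and [b] differ, each has one end left in [L], and renaming makes these the two ends of
    one edge. If [a = b], no end is left. *)
Lemma paired_join a b L : paired [:: a, b & L] -> paired (map (rename b a) L).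
Proof.
move=> H y; rewrite count_map.
have [Eab|/negPf nab] := eqVneq a b.
  rewrite Eab in H *; have := paired_behead2 H y.
  suff -> : count (preim (rename b b) (pred1 y)) L = count_mem y L by [].
  by apply: eq_count => x /=; rewrite /rename; case: (x =P b) => [->|].
(* After renaming, [b] has disappeared and [a] has received its occurrences. *)
have -> : count (preim (rename b a) (pred1 y)) L =
    ((y != b) * count_mem y L + (y == a) * count_mem b L)%N.
  elim: L {H} => [|x L IH] /=; first by rewrite !muln0.
  rewrite IH /rename; case: (x =P b) => [->|nxb].
    have [->|nyb] := eqVneq y b; first by rewrite nab; lia.
    by rewrite (eq_sym a y); case: (y == a); rewrite /= ?mul1n ?mul0n; lia.
  have [->|nyb] := eqVneq y b; rewrite /= ?mul1n ?mul0n ?add0n ?addnA //.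
  by move/eqP/negPf: nxb => ->.
have /= Ha := H a; have /= Hb := H b; have /= Hy := H y.
rewrite eqxx ?nab (eq_sym b a) ?nab in Ha Hb.
have [Ey|/negPf nya] := eqVneq y a; first by rewrite Ey nab mul1n mul1n; lia.
have [Ey|/negPf nyb] := eqVneq y b; rewrite ?mul0n ?mul1n ?addn0; first by left.
by rewrite eq_sym nya (eq_sym b) nyb in Hy.
Qed.

Lemma rename_color (A : Type) (c : nat -> A) b a x :
  c b = c a -> c (rename b a x) = c x.
Proof. by rewrite /rename => E; case: eqP => // ->. Qed.

(** * Flat colourings over Z/2 and closed components *)

Lemma addZ2 (x : 'Z_2) : x + x = 0.
Proof. by rewrite -mulr2n -mulr_natr (@char_Zp 2) // mulr0. Qed.

(** Twice a colour is zero in Z/2, so the two under-colours agree as well. *)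
Lemma flat_straight k (a b c d : 'Z_2) :
  k != Vertex -> node_rule (@flat _) k a b c d -> a = c /\ b = d.
Proof.
case: k => [||[]] //= _ [-> E]; split=> //; rewrite addZ2 in E.
  by rewrite -[b]addr0 -(addZ2 d) addrA -E add0r.
by rewrite -[a]addr0 -(addZ2 c) addrA E add0r.
Qed.

Lemma straight_flat o (a b : 'Z_2) :
  node_rule (@flat _) (Crossing o) a b a b.
Proof. by case: o; rewrite /= !addZ2. Qed.

(* Flat colourings over Z/2 are the functions that are constant along strands
   and take one value at the vertex, so this excludes closed components. *)
Definition all_through (Q : pseudodiagram) : Prop :=
  ~ colorable (@flat 'Z_2) Q.

(** A consequence of [two_bouquet] that is carried along moves and refinements; the condition on
    petals is expressed by colourings. *)
Definition regular (Q : pseudodiagram) : Prop :=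
  [/\ paired (edge_labels Q), has_vertex Q & all_through Q].

(** By induction along a petal, each edge has the colour of the vertex: the colouring is flat there,
    and it is constant along strands. *)
Lemma two_bouquet_regular Q : two_bouquet Q -> regular Q.
Proof.
case=> twice one_vertex _ petals; split.
- move=> e; case: (boolP (e \in edge_labels Q)) => [/twice|/count_memPn]; by auto.
- by rewrite /has_vertex has_count one_vertex.
case=> c colc; apply.
have [x0 Ex0] : exists x0, [seq x <- Q | x.1 == Vertex] = [:: x0].
  have : size [seq x <- Q | x.1 == Vertex] = 1%N by rewrite size_filter.
  by case: filter => [|x0 []] // _; exists x0.
exists (c (nth 0%N x0.2 0)) => e /petals; elim=> {e} [x e|x j xQ xV].
  move=> xQ xV ex; have : x \in [seq x <- Q | x.1 == Vertex].
    by rewrite mem_filter xV eqxx.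
  rewrite Ex0 inE => /eqP <-; move: (colc x xQ) ex xV => {xQ}.
  have [k [a1 [a2 [a3 [a4 ->]]]]] := node_expand x; rewrite /colored_node /= => + + kV.
  rewrite kV => -[E1 [/subr0_eq E2 /subr0_eq E3]].
  rewrite !inE => /or4P[]/eqP-> //.
  by apply: (@addrI _ (c a1)); rewrite E1 -E3 -E2.
move=> + IH; rewrite -{}IH => _.
move: (colc x xQ) xV j; have [k [a1 [a2 [a3 [a4 ->]]]]] := node_expand x.
rewrite /colored_node /= => + /eqP kV; case/(flat_straight kV) => E1 E2.
by case=> [[|[|[|[|//]]]] lt]; rewrite !(tnth_nth 0%N) /=.
Qed.

(** The indicator of [k] is a flat Z/2-colouring: it is 1 on all of [D], and [X] is covered by
    hypothesis. As there are no closed components it is constant, and it is 1 at the vertex in [D].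
    This carries a constant colour from [D] to nodes that a move removes. *)
Lemma indicator_through X D (k : nat -> bool) :
  all_through (X ++ D) -> has_vertex D ->
  {in edge_labels D, forall e, k e} ->
  coloring (@flat 'Z_2) (fun e => (k e)%:R) X ->
  {in edge_labels (X ++ D), forall e, k e}.
Proof.
move=> thr /hasP[x xD _] kD kX.
have [K HK] : monochromatic (fun e => (k e)%:R : 'Z_2) (X ++ D).
  apply: contra_notP thr => nmono; exists (fun e => (k e)%:R) => //.
  apply/coloring_cat; split=> //.
  apply: (@eq_coloring _ _ (fun=> 1)) => [e /kD->//|y yD].
  have [l [a1 [a2 [a3 [a4 ->]]]]] := node_expand y.
  by case: l => [||[]]; rewrite /colored_node /= ?subrr.
have xlab : nth 0%N x.2 0 \in edge_labels D.
  by apply: edge_labels_sub xD _ _; rewrite mem_nth // size_tuple.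
move=> e /HK; rewrite -(HK (nth 0%N x.2 0)); last first.
  by rewrite /edge_labels map_cat flatten_cat mem_cat xlab orbT.
by rewrite (kD _ xlab); case: (k e) => // /eqP.
Qed.

(** * Colourings under RI and RII *)

Lemma kink_unfold (A : comNzRingType) (S : A -> A -> Prop) o e a b D :
  paired (edge_labels (Node (Crossing o) e e a b :: D)) ->
  colorable S (relabel (rename b a) D) ->
  colorable S (Node (Crossing o) e e a b :: D).
Proof.
move=> pairD [c1]; rewrite coloring_relabel => colc nmono.
have : e \notin [:: a; b] ++ edge_labels D.
  by apply: paired_fresh pairD _; label_perm.
fresh_facts; move=> eD; pose c := c1 \o rename b a.
have cab : c b = c a by rewrite /c /= /rename eqxx; case: eqP.
exists (recolor c [:: (e, c a)]).
  rewrite coloring_cons; split; last by apply: coloring_recolor => //=; rewrite eD.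
  by rewrite /colored_node /recolor /=; fresh_simpl; case: (o); rewrite /= ?cab.
apply: contra_not nmono => -[K HK]; apply/monochromatic_relabel; exists K => x xD.
rewrite -(HK x) ?recolor_out //=; last by rewrite edge_labels_cons mem_cat xD orbT.
by rewrite inE; apply: contraNneq eD => <-.
Qed.

(** The crossing rule gives [e], [a] and [b] one colour, so the colouring descends to the joined
    diagram. If it became constant there, [indicator_through] would make it constant on the kink
    too. *)
Lemma kink_fold (A : comNzRingType) (S : A -> A -> Prop) o e a b D :
  has_vertex D -> all_through (Node (Crossing o) e e a b :: D) ->
  colorable S (Node (Crossing o) e e a b :: D) ->
  colorable S (relabel (rename b a) D).
Proof.
move=> vD thr [c]; rewrite coloring_cons /colored_node /= => -[Hx HD] nmono.
have [ea eb] : c e = c a /\ c b = c a.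
  case: (o) Hx => -[E1 E2]; rewrite E1 in E2.
    by split=> //; apply/esym/(addrI _ E2).
  by have E := addrI _ E2; rewrite -E E1.
have cren x : c (rename b a x) = c x by apply: rename_color.
exists c.
  by apply/coloring_relabel; apply: eq_coloring HD => x _; rewrite /= cren.
apply: contra_not nmono => /monochromatic_relabel[K HK]; exists K => x xQ; apply/eqP.
apply: (@indicator_through [:: Node (Crossing o) e e a b] D (fun x => c x == K)) xQ => //.
  by move=> y /HK; rewrite /= cren => ->.
rewrite coloring_cons /colored_node /= ea eb; split=> //.
exact: straight_flat.
Qed.

Definition bigon o n a b m a' b' D : pseudodiagram :=
  [:: Node (Crossing o) n a b m, Node (Crossing (~~ o)) a' n m b' & D].

Definition bigon_join a b a' b' : nat -> nat :=
  let r := rename a' a in rename (r b') (r b) \o r.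

Lemma bigon_join_eq a b a' b' :
  bigon_join a b a' b' a = bigon_join a b a' b' a' /\
  bigon_join a b a' b' b = bigon_join a b a' b' b'.
Proof.
rewrite /bigon_join /=; set r := rename a' a.
have -> : r a = r a' by rewrite /r /rename eqxx; case: eqP.
by split=> //; rewrite /rename eqxx; case: eqP.
Qed.

Lemma bigon_fresh o n a b m a' b' D :
  paired (edge_labels (bigon o n a b m a' b' D)) ->
  n \notin [:: m; a; b; a'; b'] ++ edge_labels D /\
  m \notin [:: a; b; a'; b'] ++ edge_labels D.
Proof.
move=> pairD.
have Fn : n \notin [:: m; m; a; b; a'; b'] ++ edge_labels D.
  by apply: paired_fresh pairD _; label_perm.
have Fm : m \notin [:: n; n; a; b; a'; b'] ++ edge_labels D.
  by apply: paired_fresh pairD _; label_perm.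
by split; [move: Fn | move: Fm];
  rewrite !mem_cat !inE; do ?[case: (_ == _) => //=].
Qed.

Lemma bigon_unfold (A : comNzRingType) (S : A -> A -> Prop) o n a b m a' b' D :
  paired (edge_labels (bigon o n a b m a' b' D)) ->
  colorable S (relabel (bigon_join a b a' b') D) ->
  colorable S (bigon o n a b m a' b' D).
Proof.
move=> pairD [c1]; rewrite coloring_relabel => colc nmono.
have [] := bigon_fresh pairD; fresh_facts => nD; fresh_facts => mD.
pose c := c1 \o bigon_join a b a' b'.
have [ca cb] : c a' = c a /\ c b' = c b.
  by rewrite /c /=; have [-> ->] := bigon_join_eq a b a' b'.
(* The rule at the first crossing dictates the colours of the bigon sides; the second crossing then
   holds because [a'], [b'] have the colours of [a], [b]. *)
exists (recolor c [:: (n, if o then c b else c a + c a - c b);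
                      (m, if o then c b + c b - c a else c a)]).
  rewrite !coloring_cons; split; [|split].
  - rewrite /colored_node /recolor /=; fresh_simpl.
    by case: (o) => /=; split=> //; ring.
  - rewrite /colored_node /recolor /=; fresh_simpl; rewrite ca cb.
    by case: (o) => /=; split=> //; ring.
  by apply: coloring_recolor => //=; rewrite nD mD.
apply: contra_not nmono => -[K HK]; apply/monochromatic_relabel; exists K => x xD.
rewrite -(HK x) ?recolor_out //=; last by rewrite !edge_labels_cons !mem_cat xD !orbT.
by rewrite !inE negb_or; apply/andP; split; [apply: contraNneq nD | apply: contraNneq mD] => <-.
Qed.

(** The lower strand is reflected twice in the same colour, so both strands leave the bigon with the
    colours they had on entering. The nonconstant colouring stays nonconstant for the same reason as
    for a kink. *)
Lemma bigon_fold (A : comNzRingType) (S : A -> A -> Prop) o n a b m a' b' D :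
  paired (edge_labels (bigon o n a b m a' b' D)) ->
  has_vertex D -> all_through (bigon o n a b m a' b' D) ->
  colorable S (bigon o n a b m a' b' D) ->
  colorable S (relabel (bigon_join a b a' b') D).
Proof.
move=> pairD vD thr [c]; rewrite !coloring_cons /colored_node /= => -[H1 [H2 HD]] nmono.
have [] := bigon_fresh pairD; fresh_facts => nD; fresh_facts => mD.
have [ca cb] : c a' = c a /\ c b' = c b.
  case: (o) H1 H2 => -[E1 E2] [E3 E4].
    by split; [apply: (addIr (c m)); rewrite E4 -E3 -E2 E1 | rewrite -E3 E1].
  by split; [rewrite E3 E1 | apply: (addrI (c n)); rewrite -E4 E2 E3 E1].
have cjoin x : c (bigon_join a b a' b' x) = c x.
  by rewrite /bigon_join /= !rename_color.
exists c.
  by apply/coloring_relabel; apply: eq_coloring HD => x _; rewrite /= cjoin.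
apply: contra_not nmono => /monochromatic_relabel[K HK]; exists K.
(* A flat Z/2-colouring is constant along strands, so the sides [n] and [m] receive the values of
   [b] and [a] instead of a test of their own colours. *)
pose k := recolor (fun x => c x == K) [:: (n, c b == K); (m, c a == K)].
have Hk : {in edge_labels (bigon o n a b m a' b' D), forall x, k x}.
  apply: (@indicator_through [:: Node (Crossing o) n a b m;
            Node (Crossing (~~ o)) a' n m b'] D k) => //.
    move=> x xD; rewrite /k recolor_out /=; first by rewrite -(HK x xD) /= cjoin.
    by rewrite !inE negb_or; apply/andP; split; [apply: contraNneq nD | apply: contraNneq mD] => <-.
  rewrite !coloring_cons /colored_node /k /recolor /=; fresh_simpl; rewrite ca cb.
  by split; [|split] => //; apply: straight_flat.
have Ka : c a = K.
  have /Hk : a \in edge_labels (bigon o n a b m a' b' D) by rewrite !inE eqxx ?orbT.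
  by rewrite /k /recolor /=; fresh_simpl => /eqP.
have Kb : c b = K.
  have /Hk : b \in edge_labels (bigon o n a b m a' b' D) by rewrite !inE eqxx ?orbT.
  by rewrite /k /recolor /=; fresh_simpl => /eqP.
have [Kn Km] : c n = K /\ c m = K.
  case: (o) H1 => /= -[E1 E2]; rewrite ?Ka ?Kb in E1 E2.
    by rewrite E1 in E2; split=> //; apply/esym/(addrI K).
  by rewrite -E1 in E2; split=> //; apply/(addIr K).
move=> x xQ; case: (eqVneq x n) => [->//|xn]; case: (eqVneq x m) => [->//|xm].
by have := Hk x xQ; rewrite /k recolor_out /= ?inE ?negb_or ?xn ?xm // => /eqP.
Qed.

(** * Invariance under changes of code and along equivalences *)

Lemma turn_kindK : involutive turn_kind.
Proof. by case=> [||[]]. Qed.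

Lemma colored_node_rotate (A : comNzRingType) (S : A -> A -> Prop) c x :
  turn_invariant S -> colored_node S c (rotate x) <-> colored_node S c x.
Proof.
move=> turnS; have [k [a1 [a2 [a3 [a4 ->]]]]] := node_expand x.
rewrite rotate_Node /colored_node /=; split; last exact: node_rule_turn.
do 3![move/(node_rule_turn turnS)]; by rewrite !turn_kindK.
Qed.

Lemma rotate_labels x Q :
  perm_eq (edge_labels (x :: Q)) (edge_labels (rotate x :: Q)).
Proof.
have [k [a1 [a2 [a3 [a4 ->]]]]] := node_expand x; rewrite rotate_Node.
label_perm.
Qed.

Lemma injective_in_cancel (f : nat -> nat) (L : seq nat) :
  {in L &, injective f} -> exists g, {in L, cancel f g}.
Proof.
move=> injf; exists (fun y => nth 0%N L (index y (map f L))) => x xL.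
have fx : f x \in map f L by apply: map_f.
apply: injf => //; first by rewrite mem_nth // -(size_map f) index_mem.
by rewrite -(nth_map 0%N 0%N f) ?nth_index // -(size_map f) index_mem.
Qed.

Lemma same_diagram_colorable (A : comNzRingType) (S : A -> A -> Prop) Q Q' :
  turn_invariant S -> same_diagram Q Q' -> colorable S Q <-> colorable S Q'.
Proof.
move=> turnS; case=> [{}Q {}Q' pQ|x {}Q|f {}Q injf].
- split=> -[c colc nmono]; exists c.
  + exact: coloring_perm colc.
  + apply: contra_not nmono; apply: perm_monochromatic.
    by apply/perm_mem/perm_edge_labels.
  + by apply: coloring_perm colc; rewrite perm_sym.
  + apply: contra_not nmono; apply: perm_monochromatic.
    by apply/perm_mem; rewrite perm_sym perm_edge_labels.
- have memL := perm_mem (rotate_labels x Q).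
  split=> -[c colc nmono]; exists c.
  + by move: colc; rewrite !coloring_cons colored_node_rotate.
  + by apply: contra_not nmono; apply: perm_monochromatic => e; rewrite memL.
  + by move: colc; rewrite !coloring_cons colored_node_rotate.
  + by apply: contra_not nmono; apply: perm_monochromatic.
- split=> -[c].
    move=> colc nmono; have [g fK] := injective_in_cancel injf; exists (c \o g).
      by apply/coloring_relabel; apply: eq_coloring colc => x /fK /= ->.
    apply: contra_not nmono => /monochromatic_relabel; apply: eq_monochromatic.
    by move=> x /fK /= ->.
  by rewrite coloring_relabel monochromatic_relabel; exists (c \o f).
Qed.

Lemma paired_map f L :
  {in L &, injective f} -> paired L -> paired (map f L).
Proof.
move=> injf pairL y; case: (boolP (y \in map f L)) => [|/count_memPn]; last by left.
case/mapP=> x xL ->; have := pairL x; rewrite count_map.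
suff -> : count (preim f (pred1 (f x))) L = count_mem x L by [].
by apply: eq_in_count => z zL /=; apply/eqP/eqP => [/injf->|->].
Qed.

Lemma same_diagram_regular Q Q' : same_diagram Q Q' -> regular Q -> regular Q'.
Proof.
move=> sameQ [pairQ vQ thrQ]; split; last first.
- by move/(same_diagram_colorable (@flat_turn _) sameQ).
- case: sameQ vQ {pairQ thrQ} => [{}Q {}Q' pQ|x {}Q|f {}Q _]; rewrite /has_vertex.
  + by rewrite (perm_has _ pQ).
  + have [k [a1 [a2 [a3 [a4 ->]]]]] := node_expand x.
    by rewrite rotate_Node /=; case: k.
  + by rewrite has_map.
- case: sameQ pairQ {vQ thrQ} => [{}Q {}Q' pQ|x {}Q|f {}Q injf].
  + by apply/paired_perm/perm_edge_labels.
  + by apply/paired_perm/rotate_labels.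
  + by rewrite edge_labels_relabel; apply: paired_map.
Qed.

Lemma has_vertex_relabel f Q : has_vertex (relabel f Q) = has_vertex Q.
Proof. by rewrite /has_vertex has_map. Qed.

(** [all_through] is the absence of a flat colouring, so its preservation is an instance of the
    invariance of colourability. *)
Lemma reidemeister_regular Q Q' : reidemeister Q Q' -> regular Q ->
  regular Q' /\
  forall (A : comNzRingType) (S : A -> A -> Prop), turn_invariant S ->
    colorable S Q <-> colorable S Q'.
Proof.
move=> moveQ [pairQ vQ thrQ].
suff [[pairQ' vQ'] colQ] : (paired (edge_labels Q') /\ has_vertex Q') /\
    forall (A : comNzRingType) (S : A -> A -> Prop), turn_invariant S ->
    colorable S Q <-> colorable S Q'.
  by do !split=> //; rewrite /all_through -colQ //; apply: flat_turn.
case: moveQ pairQ vQ thrQ => {Q Q'}.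
- move=> o e a b D pairD vD thrD; split.
    rewrite has_vertex_relabel edge_labels_relabel; split=> //.
    by apply: paired_join; apply: (@paired_behead2 e).
  move=> A S _; split; first exact: kink_fold.
  exact: kink_unfold.
- move=> o a m a' b n b' D r pairD vD thrD; split.
    rewrite has_vertex_relabel edge_labels_relabel map_comp; split=> //.
    apply: paired_join; rewrite -[_ :: _]/(map r [:: b, b' & edge_labels D]).
    apply: paired_join; apply: (@paired_behead2 n); apply: (@paired_behead2 m).
    apply: paired_perm pairD; label_perm.
  move=> A S _; split; first exact: bigon_fold.
  exact: bigon_unfold.
- move=> o o' ne nw sw se s t p q m D pairD vD _; split.
    split=> //; apply: paired_perm pairD; exact: slide_labels.
  by move=> A S turnS; apply: slide_colorable.
- move=> o ne nw sw se s t p q m D pairD vD _; split.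
    split=> //; apply: paired_perm pairD; exact: slide_labels.
  by move=> A S turnS; apply: slide_colorable.
- move=> o ne nw sw se p q D pairD vD _; split.
    split=> //; apply: paired_perm pairD; exact: flip_labels.
  by move=> A S turnS; apply: flip_colorable.
Qed.

Lemma move_regular Q Q' : move Q Q' -> regular Q ->
  regular Q' /\
  forall (A : comNzRingType) (S : A -> A -> Prop), turn_invariant S ->
    colorable S Q <-> colorable S Q'.
Proof.
case=> [sameQ|moveQ]; last exact: reidemeister_regular.
move=> regQ; split; first exact: same_diagram_regular regQ.
by move=> A S turnS; apply: same_diagram_colorable.
Qed.

(** A backward step carries the fact that its result is a 2-bouquet, hence regular; the forward
    statement applies to that result and is read in reverse. *)
Lemma equivalent_regular Q Q' : equivalent Q Q' -> regular Q ->
  regular Q' /\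
  forall (A : comNzRingType) (S : A -> A -> Prop), turn_invariant S ->
    colorable S Q <-> colorable S Q'.
Proof.
elim=> {Q Q'} [Q Q' [|[/two_bouquet_regular regQ' moveQ]]|Q|Q Q' Q'' _ IH _ IH' regQ].
- exact: move_regular.
- move=> _; have [regQ colQ] := move_regular moveQ regQ'; split=> // A S turnS.
  by apply: iff_sym; apply: colQ.
- by move=> regQ; split.
have [regQ' colQ] := IH regQ; have [regQ'' colQ'] := IH' regQ'.
by split=> // A S turnS; apply: iff_trans (colQ _ _ turnS) (colQ' _ _ turnS).
Qed.

(* The vertex is seen with slope 0, infinity, 1 or -1. *)
Definition unit_slope (u v : int) : Prop :=
  [/\ `|u| <= 1, `|v| <= 1 & (u != 0) || (v != 0)].

Lemma unit_slope_turn : turn_invariant unit_slope.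
Proof. by move=> u v [hu hv nz]; split; rewrite /= in hu hv *; lia. Qed.

Local Close Scope ring_scope.

(** * Pretzel diagrams and their resolutions *)

(* [stack], [columns] and [pretzel] with prescribed kinds of double points. *)
Fixpoint strip (l r l' r' : nat) (ks : seq kind) (f : nat) : pseudodiagram :=
  match ks with
  | [::] => [::]
  | [:: k] => [:: Node k r l l' r']
  | k :: ks' => Node k r l f f.+1 :: strip f f.+1 l' r' ks' f.+2
  end.

Fixpoint strips (i f : nat) (kss : seq (seq kind)) : pseudodiagram :=
  if kss is ks :: kss' then
    strip i.*2 i.+1.*2 i.*2.+1 i.+1.*2.+1 ks f ++ strips i.+1 (f + (size ks).*2) kss'
  else [::].

Definition strip_pretzel (kss : seq (seq kind)) : pseudodiagram :=
  let k := size kss in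
  Node Vertex 0 k.*2 k.*2.+1 1 :: strips 0 k.*2.+2 kss.

Lemma strip_cons2 l r l' r' k k' ks f :
  strip l r l' r' [:: k, k' & ks] f =
  Node k r l f f.+1 :: strip f f.+1 l' r' (k' :: ks) f.+2.
Proof. by []. Qed.

Lemma stack_strip l r l' r' x f :
  stack l r l' r' x f = strip l r l' r' (nseq x Precrossing) f.
Proof. by elim: x l r f => // -[|x] // IH l r f; rewrite strip_cons2 -IH. Qed.

Lemma pretzel_strip xs :
  pretzel xs = strip_pretzel [seq nseq x Precrossing | x <- xs].
Proof.
rewrite /pretzel /strip_pretzel size_map; congr (_ :: _).
elim: xs 0 (size xs).*2.+2 => //= x xs IH i f.
by rewrite stack_strip IH size_nseq.
Qed.

Definition kind_refines (k k' : kind) : bool :=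
  (k' == k) || (k == Precrossing) && (k' != Vertex).

Lemma refinesP Q Q' :
  refines Q Q' = all2 (fun x x' : node => (x'.2 == x.2) && kind_refines x.1 x'.1) Q Q'.
Proof. by []. Qed.

Lemma all2_catl (T U : Type) (r : T -> U -> bool) s1 s2 t :
  all2 r (s1 ++ s2) t ->
  exists t1 t2, [/\ t = t1 ++ t2, all2 r s1 t1 & all2 r s2 t2].
Proof.
elim: s1 t => [|x s1 IH] [|y t] //=; try by exists [::]; eexists.
by case/andP=> rxy /IH[t1 [t2 [-> r1 r2]]]; exists (y :: t1), t2; rewrite /= rxy.
Qed.

Lemma all2_cat2 (T U : Type) (r : T -> U -> bool) s1 s2 t1 t2 :
  all2 r s1 t1 -> all2 r s2 t2 -> all2 r (s1 ++ s2) (t1 ++ t2).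
Proof. by elim: s1 t1 => [|x s1 IH] [|y t1] //= /andP[-> /IH]. Qed.

Lemma all2_size (T U : Type) (r : T -> U -> bool) s t : all2 r s t -> size s = size t.
Proof. by elim: s t => [|x s IH] [|y t] //= /andP[_ /IH->]. Qed.

Lemma strip_refined l r l' r' ks f Q :
  refines (strip l r l' r' ks f) Q ->
  exists2 ks', Q = strip l r l' r' ks' f & all2 kind_refines ks ks'.
Proof.
elim: ks l r f Q => [|k ks IH] l r f Q; first by case: Q => // _; exists [::].
case: ks IH => [|k2 ks] IH.
  case: Q => [|[k' t] [|]] //=; rewrite ?andbF // andbT => /andP[/eqP/= -> kk].
  by exists [:: k']; rewrite //= andbT.
rewrite strip_cons2 refinesP /=; case: Q => [|[k' t] Q] //.
case/andP=> /andP[/eqP/= -> kk] /IH[ks' -> kks].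
exists (k' :: ks'); last by rewrite /= kk.
by case: ks' kks.
Qed.

Lemma strip_refines l r l' r' ks ks' f :
  all2 kind_refines ks ks' ->
  refines (strip l r l' r' ks f) (strip l r l' r' ks' f).
Proof.
elim: ks ks' l r f => [|k ks IH] [|k' ks'] // l r f.
case: ks ks' IH => [|k2 ks] [|k2' ks'] IH; first by rewrite refinesP /= eqxx.
- by rewrite /= andbF.
- by rewrite /= andbF.
rewrite !strip_cons2 => /andP[kk /(IH (k2' :: ks')) kks]; rewrite refinesP /= eqxx.
by move: kk; rewrite /kind_refines => ->; apply: kks.
Qed.

Lemma strip_pretzel_refined kss Q :
  refines (strip_pretzel kss) Q ->
  exists2 kss', Q = strip_pretzel kss' & all2 (all2 kind_refines) kss kss'.
Proof.
rewrite refinesP /strip_pretzel /=; case: Q => [|[k t] Q] //= /andP[/andP[/eqP/= -> kV] ref].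
have {kV} -> : k = Vertex by case/orP: kV => // /eqP.
suff H i f : refines (strips i f kss) Q -> exists2 kss',
    Q = strips i f kss' & all2 (all2 kind_refines) kss kss'.
  have [kss' -> kks] := H _ _ ref; exists kss' => //.
  by rewrite (all2_size kks).
elim: kss i f Q {ref} => [|ks kss IH] i f Q /=.
  by case: Q => // _; exists [::].
rewrite refinesP => /all2_catl[Q1 [Q2 [-> /strip_refined[ks' -> kk] /IH[kss' -> kks]]]].
by exists (ks' :: kss'); rewrite /= ?kk // (all2_size kk).
Qed.

Lemma strip_pretzel_refines kss kss' :
  all2 (all2 kind_refines) kss kss' ->
  refines (strip_pretzel kss) (strip_pretzel kss').
Proof.
move=> kks; rewrite refinesP /strip_pretzel (all2_size kks) /= eqxx /=.
suff H i f : refines (strips i f kss) (strips i f kss') by apply: H.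
elim: kss kss' i f kks => [|ks kss IH] [|ks' kss'] //= i f.
case/andP=> kk kks; rewrite -(all2_size kk).
by apply: all2_cat2; [apply: strip_refines | apply: IH].
Qed.

Lemma precrossings_strip_pretzel kss :
  precrossings (strip_pretzel kss) = count_mem Precrossing (flatten kss).
Proof.
rewrite /precrossings /strip_pretzel /= add0n.
suff H i f : precrossings (strips i f kss) = count_mem Precrossing (flatten kss).
  exact: H.
rewrite /precrossings; elim: kss i f => //= ks kss IH i f.
rewrite !count_cat IH; congr addn.
move: i.*2.+1 i.+1.*2.+1 => l' r'; move: i.*2 i.+1.*2 => l r.
elim: ks l r f {IH} => // k ks IH l r f.
by case: ks IH => [|k2 ks] IH //=; have /= -> := IH f f.+1 f.+2.
Qed.

(** A flat Z/2-colouring of the refinement also colours the original, since crossings too leave both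
    strands constant. *)
Lemma refines_regular Q Q' : refines Q Q' -> regular Q -> regular Q'.
Proof.
move=> ref [pairQ vQ thrQ].
have labE : edge_labels Q' = edge_labels Q.
  rewrite /edge_labels; elim: Q Q' ref {pairQ vQ thrQ} => [|x Q IH] [|x' Q'] //=.
  by case/andP=> /andP[/eqP-> _] /IH->.
split; first by rewrite labE.
  rewrite /has_vertex; elim: Q Q' ref vQ {pairQ thrQ labE} => [|x Q IH] [|x' Q'] //=.
  case/andP=> /andP[_ kk] /IH{}IH /orP[/eqP xV|/IH->]; last by rewrite orbT.
  by rewrite xV in kk; case/orP: kk => [->|].
apply: contra_not thrQ => -[c colc nmono]; exists c; last first.
  by apply: contra_not nmono => -[K HK]; exists K => e; rewrite labE; apply: HK.
elim: Q Q' ref colc {pairQ vQ nmono labE} => [|x Q IH] [|x' Q'] //.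
case/andP=> /andP[/eqP E kk] /IH{}IH; rewrite !coloring_cons => -[Hx /IH]; split=> //.
case/orP: kk => [/eqP kE|/andP[/eqP kP kV]].
  by move: Hx; rewrite /colored_node E kE.
by move: Hx; rewrite /colored_node E kP => /(flat_straight kV).
Qed.

Lemma precrossings_all_crossings kss :
  all (all (fun k => k != Vertex)) kss -> precrossings (strip_pretzel kss) = 0 ->
  exists ss, kss = [seq [seq Crossing b | b <- s] | s <- ss].
Proof.
rewrite precrossings_strip_pretzel.
elim: kss => [|ks kss IH] /=; first by exists [::].
case/andP=> ksV /IH{}IH /eqP; rewrite count_cat addn_eq0 => /andP[/eqP ks0 /eqP/IH[ss ->]].
have [s ->] : exists s, ks = [seq Crossing b | b <- s].
  elim: ks ksV ks0 => [|k ks IHk] /=; first by exists [::].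
  case/andP=> kV /IHk{}IHk; case: k kV => [||b] //= _; rewrite add0n => /IHk[s ->].
  by exists (b :: s).
by exists (s :: ss).
Qed.

(* The shape of a fully resolved pretzel diagram, whatever its inner labels; an
   empty stack stands for two vertical strands. *)
Fixpoint is_twist (s : seq bool) (l r l' r' : nat) (Q : pseudodiagram) : Prop :=
  if s is b :: s' then
    exists f g Q', Q = Node (Crossing b) r l f g :: Q' /\ is_twist s' f g l' r' Q'
  else [/\ Q = [::], l' = l & r' = r].

(** [a], [a'] are the upper and lower edges that enter the row on the left; [z], [z'] are those that
    leave it on the right. *)
Fixpoint is_twists (ss : seq (seq bool)) (a a' z z' : nat) (Q : pseudodiagram) : Prop :=
  if ss is s :: ss' then
    exists b b' Q1 Q2, [/\ Q = Q1 ++ Q2, is_twist s a b a' b' Q1 &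
                           is_twists ss' b b' z z' Q2]
  else [/\ Q = [::], z = a & z' = a'].

Definition is_pretzel (ss : seq (seq bool)) (Q : pseudodiagram) : Prop :=
  exists a a' z z' Q', perm_eq Q (Node Vertex a z z' a' :: Q') /\
    is_twists ss a a' z z' Q'.

Definition crossings (ss : seq (seq bool)) : seq (seq kind) :=
  [seq [seq Crossing b | b <- s] | s <- ss].

Lemma is_twist_strip s l r l' r' f :
  s != [::] -> is_twist s l r l' r' (strip l r l' r' [seq Crossing b | b <- s] f).
Proof.
elim: s l r f => // b s IH l r f _; case: s IH => [|b2 s] IH.
  by exists l', r', [::].
exists f, f.+1, (strip f f.+1 l' r' [seq Crossing b | b <- b2 :: s] f.+2).
by split=> //; apply: IH.
Qed.

Lemma is_pretzel_strip ss :
  all (fun s => s != [::]) ss -> is_pretzel ss (strip_pretzel (crossings ss)).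
Proof.
move=> nss; exists 0, 1, (size ss).*2, (size ss).*2.+1; eexists; split.
  by rewrite /strip_pretzel size_map; apply: perm_refl.
suff H i f : is_twists ss i.*2 i.*2.+1 (i + size ss).*2 (i + size ss).*2.+1
    (strips i f (crossings ss)) by apply: (H 0).
elim: ss i f nss => [|s ss IH] i f /=; first by rewrite addn0.
case/andP=> ns nss; do 4!eexists; split=> //; first exact: is_twist_strip.
by rewrite -addSnnS; apply: IH.
Qed.

(** * Net twists and the colours of a pretzel diagram *)

Local Open Scope ring_scope.

(** [Crossing true] counts 1 and [Crossing false] counts -1. *)
Definition net (s : seq bool) : int := \sum_(b <- s) (-1) ^+ (~~ b).

Lemma net_cons b s : net (b :: s) = (-1) ^+ (~~ b) + net s.
Proof. by rewrite /net big_cons. Qed.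

Lemma net_nil : net [::] = 0.
Proof. by rewrite /net big_nil. Qed.

Lemma net_cat s t : net (s ++ t) = net s + net t.
Proof. by rewrite /net big_cat. Qed.

Lemma net_nseq n b : net (nseq n b) = (-1) ^+ (~~ b) * n%:Z.
Proof.
elim: n => [|n IH]; first by rewrite net_nil mulr0.
by rewrite /= net_cons IH intS mulrDr mulr1.
Qed.

(** One crossing adds plus or minus [c r - c l] to both colours and hence preserves their
    difference, so the shifts add up. *)
Lemma twist_color (A : comNzRingType) (S : A -> A -> Prop) c s l r l' r' Q :
  is_twist s l r l' r' Q -> coloring S c Q ->
  c l' = c l + (net s)%:~R * (c r - c l) /\
  c r' = c r + (net s)%:~R * (c r - c l).
Proof.
elim: s l r Q => [|b s IH] l r Q /=.
  by case=> _ -> -> _; rewrite net_nil mul0r !addr0.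
case=> f [g [Q' [-> tw]]]; rewrite coloring_cons /colored_node /= => -[Hb /(IH _ _ _ tw)[-> ->]].
rewrite net_cons rmorphD rmorphXn rmorphN1 /=.
case: b Hb => /= -[E1 E2]; rewrite ?expr0 ?expr1.
  have -> : c g = c r + c f - c l by rewrite E2; ring.
  by rewrite -E1; split; ring.
have -> : c f = c l + c g - c r by rewrite -E2; ring.
by rewrite -E1; split; ring.
Qed.

(** [ds] lists the horizontal differences across the columns. A column shifts its two colours
    equally, so the vertical difference is the same on its left and on its right. *)
Lemma twists_color (A : comNzRingType) (S : A -> A -> Prop) c ss a a' z z' Q :
  is_twists ss a a' z z' Q -> coloring S c Q ->
  exists ds, [/\ all2 (fun s d => (net s)%:~R * d == c a' - c a) ss ds,
    c z - c a = \sum_(d <- ds) d & c z' - c z = c a' - c a].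
Proof.
elim: ss a a' Q => [|s ss IH] a a' Q /=.
  by case=> _ -> -> _; exists [::]; rewrite big_nil subrr.
case=> b [b' [Q1 [Q2 [-> tw tws]]]]; rewrite coloring_cat => -[col1 col2].
have [Ea' Eb'] := twist_color tw col1.
have [ds [Hds Ez Ez']] := IH _ _ _ tws col2.
have Eb : c b' - c b = c a' - c a by rewrite Ea' Eb'; ring.
exists ((c b - c a) :: ds); rewrite -Eb Hds andbT; split=> //.
  by apply/eqP; rewrite Eb'; ring.
rewrite big_cons -Ez; ring.
Qed.

(** * Obstructions to triviality *)

Lemma trivial_K_slope : colorable unit_slope trivial_K.
Proof.
exists (fun e => e%:Z).
  by move=> x; rewrite inE => /eqP->.
by case=> K HK; have := HK 0%N isT; rewrite -(HK 1%N isT).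
Qed.

Lemma trivial_L_slope : colorable unit_slope trivial_L.
Proof.
exists (fun e => (nth 0%N [:: 0; 1; 2; 1]%N e)%:Z).
  by move=> x; rewrite !inE => /orP[]/eqP->.
by case=> K HK; have := HK 0%N isT; rewrite -(HK 1%N isT).
Qed.

Lemma flat_vertex (A : comNzRingType) (a b c d : A) :
  node_rule (@flat A) Vertex a b c d -> [/\ b = a, c = a & d = a].
Proof.
case=> E [/subr0_eq Ed /subr0_eq Eb]; split=> //.
by apply: (addrI a); rewrite E -Eb -Ed.
Qed.

(** In both codes every edge ends at the vertex, where the colouring is constant. *)
Lemma trivial_flat (A : comNzRingType) Q :
  Q = trivial_K \/ Q = trivial_L -> ~ colorable (@flat A) Q.
Proof.
move=> EQ [c colc]; apply; exists (c 0%N).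
case: EQ colc => ->; rewrite coloring_cons /colored_node => -[/flat_vertex/= []].
  by move=> _ E1 _ _ e; rewrite !inE => /or4P[]/eqP->.
by move=> E1 E2 E3 _ e; rewrite !inE; do 7?[case/predU1P=> [->//|]] => /eqP->.
Qed.

Lemma slope_nontrivial Q :
  regular Q -> ~ colorable unit_slope Q -> ~ trivial_diagram Q.
Proof.
move=> regQ ncol [] /equivalent_regular/(_ regQ)[_ colQ]; apply: ncol;
  apply/(colQ _ _ unit_slope_turn).
- exact: trivial_K_slope.
- exact: trivial_L_slope.
Qed.

Lemma flat_nontrivial (A : comNzRingType) Q :
  regular Q -> colorable (@flat A) Q -> ~ trivial_diagram Q.
Proof.
move=> regQ col [] /equivalent_regular/(_ regQ)[_ colQ];
  move/(colQ _ _ (@flat_turn _)): col; apply: trivial_flat; by [left | right].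
Qed.

(** [h] is the vertical difference at the vertex, and the sum of [ds] is the horizontal one. *)
Lemma pretzel_slope ss Q :
  is_pretzel ss Q -> colorable unit_slope Q ->
  exists (h : int) ds, [/\ all2 (fun s d => net s * d == h) ss ds,
    `|h| <= 1, `|\sum_(d <- ds) d| <= 1 & (h != 0) || (\sum_(d <- ds) d != 0)].
Proof.
move=> [a [a' [z [z' [Q' [pQ tw]]]]]] [c colc _].
have := coloring_perm pQ colc; rewrite coloring_cons => -[Hv col'].
have [ds [Hds Ez _]] := twists_color tw col'.
exists (c a' - c a), ds; rewrite -Ez.
have Hds' : all2 (fun s d => net s * d == c a' - c a) ss ds.
  by elim: ss ds {tw Ez} Hds => [|s ss IH] [|d ds] //= /andP[]; rewrite intz => -> /IH.
case: Hv => /= _ [h1 h2 h3]; split=> //; lia.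
Qed.

(** If [h = 0], all differences vanish, against the slope being defined. Otherwise a column with net
    twist at least 2 in absolute value makes [h] too large; if all net twists are 1 or -1, each [d]
    is [h * net s], and their sum is too large. *)
Lemma no_slope ss Q :
  is_pretzel ss Q -> all (fun s => net s != 0) ss ->
  has (fun s => 2 <= `|net s|) ss || (2 <= `|\sum_(s <- ss) net s|) ->
  ~ colorable unit_slope Q.
Proof.
move=> prQ net0 wide /(pretzel_slope prQ)[h [ds [Hds h1 sum1 nz]]].
have [h0|h0] := eqVneq h 0.
  move: nz; rewrite h0 /= big1_seq ?eqxx // => d /andP[_] {wide sum1 prQ}.
  elim: ss ds Hds net0 => [|s ss IH] [|e ds] //= /andP[/eqP E Hds] /andP[n0 /IH{}IH].
  rewrite inE => /predU1P[->|]; last exact: IH.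
  by move/eqP: E; rewrite h0 mulf_eq0 (negPf n0) => /eqP.
have [nwide|/hasPn narrow] := boolP (has (fun s => 2 <= `|net s|) ss).
  elim: ss ds Hds nwide {prQ net0 wide sum1 nz} => [|s ss IH] [|e ds] //=.
  case/andP=> /eqP E Hds /orP[s2|]; last exact: IH Hds.
  have e0 : e != 0 by apply: contraNneq h0 => e0; rewrite -E e0 mulr0.
  rewrite -E normrM in h1; nia.
move: wide; rewrite (introF hasP) ?orFb => [sum2|]; last by case=> s /narrow/negPf->.
suff E : \sum_(d <- ds) d = h * \sum_(s <- ss) net s.
  by rewrite E normrM in sum1; nia.
elim: ss ds Hds net0 narrow {prQ sum1 nz sum2} => [|s ss IH] [|e ds] //=.
  by rewrite !big_nil mulr0.
case/andP=> /eqP Ed Hds /andP[n0 net0] narrow; rewrite !big_cons mulrDr -(IH ds) //; last first.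
  by move=> t tss; apply: narrow; rewrite inE tss orbT.
congr (_ + _); have : `|net s| < 2 by have := narrow s; rewrite inE eqxx => /(_ isT); lia.
rewrite -Ed => n2; have [->|->] : net s = 1 \/ net s = -1 by lia.
  by rewrite mul1r mulr1.
by rewrite mulN1r mulrN1 opprK.
Qed.

(** A converse of [twist_color]: corner colours that satisfy its equations extend to the inner
    edges, whose labels start at [f] and so do not meet the corners. *)
Lemma strip_extend (A : comNzRingType) (S : A -> A -> Prop) (s : seq bool)
    l r l' r' f (c : nat -> A) :
  s != [::] -> (l < f)%N -> (r < f)%N -> (l' < f)%N -> (r' < f)%N ->
  c l' = c l + (net s)%:~R * (c r - c l) ->
  c r' = c r + (net s)%:~R * (c r - c l) ->
  exists2 c' : nat -> A, (forall x, (x < f)%N -> c' x = c x) &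
    coloring S c' (strip l r l' r' [seq Crossing b | b <- s] f).
Proof.
elim: s l r f c => // b s IH l r f c _ lf rf l'f r'f.
rewrite net_cons rmorphD rmorphXn rmorphN1 /= => El' Er'.
case: s IH El' Er' => [|b2 s] IH El' Er'.
  exists c => //; rewrite coloring_cons; split=> //.
  move: El' Er'; rewrite net_nil addr0 /colored_node /= => -> ->.
  by case: b; rewrite /= ?expr0 ?expr1; split; ring.
(* The shift caused by the first crossing. *)
pose v := (-1) ^+ (~~ b) * (c r - c l).
pose c1 := recolor c [:: (f, c l + v); (f.+1, c r + v)].
have c1f : c1 f = c l + v by rewrite /c1 /recolor /= eqxx.
have c1f1 : c1 f.+1 = c r + v.
  by rewrite /c1 /recolor /= eqxx; case: eqP => //; lia.
have c1lt x : (x < f)%N -> c1 x = c x.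
  by move=> xf; rewrite /c1 recolor_out //= !inE; lia.
have [] := IH f f.+1 f.+2 c1; rewrite ?c1f ?c1f1 ?(c1lt l') ?(c1lt r') //; try lia.
- by rewrite El' /v; ring.
- by rewrite Er' /v; ring.
move=> c' c'lt colc'; exists c' => [x xf|]; first by rewrite c'lt ?c1lt //; lia.
rewrite !map_cons coloring_cons; split=> //.
rewrite /colored_node /= !c'lt ?c1f ?c1f1 ?c1lt //; try lia.
by rewrite /v; case: b {v c1 c1f c1f1 c1lt El' Er' c'lt}; rewrite /= ?expr0 ?expr1; split; ring.
Qed.

Lemma strip_labels_lt l r l' r' ks f e :
  (l < f)%N -> (r < f)%N -> (l' < f)%N -> (r' < f)%N ->
  e \in edge_labels (strip l r l' r' ks f) -> (e < f + (size ks).*2)%N.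
Proof.
elim: ks l r f => // k ks IH l r f lf rf l'f r'f; case: ks IH => [|k2 ks] IH.
  by rewrite /edge_labels /= !inE => /or4P[]/eqP->; lia.
rewrite strip_cons2 edge_labels_cons mem_cat => /orP[].
  by rewrite !inE => /or4P[]/eqP->; rewrite /=; lia.
by move/IH; rewrite /=; lia.
Qed.

Lemma strips_extend (A : comNzRingType) (S : A -> A -> Prop) (ss : seq (seq bool))
    i f (c : nat -> A) :
  all (fun s => s != [::]) ss -> ((i + size ss).*2.+1 < f)%N ->
  (forall t, (t < size ss)%N ->
     let d := (net (nth [::] ss t))%:~R * (c (i + t).+1.*2 - c (i + t).*2) in
     c (i + t).*2.+1 = c (i + t).*2 + d /\ c (i + t).+1.*2.+1 = c (i + t).+1.*2 + d) ->
  exists2 c' : nat -> A, (forall x, (x < f)%N -> c' x = c x) &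
    coloring S c' (strips i f (crossings ss)).
Proof.
elim: ss i f c => [|s ss IH] i f c /=; first by exists c.
case/andP=> ns nss sz compat.
have [E E'] := compat 0%N isT; rewrite addn0 in E E'.
have [] := @strip_extend A S s i.*2 i.+1.*2 i.*2.+1 i.+1.*2.+1 f c ns; rewrite ?E ?E' //; try lia.
move=> c1 c1lt col1.
have [] := IH i.+1 (f + (size s).*2)%N c1 nss; first by lia.
  move=> t tss; rewrite !c1lt; try lia.
  by have := compat t.+1 tss; rewrite addnS.
move=> c' c'lt col'; exists c' => [x xf|]; first by rewrite c'lt ?c1lt //; lia.
rewrite coloring_cat size_map; split=> //.
apply: eq_coloring col1 => x /strip_labels_lt H; rewrite c'lt //.
by rewrite -(size_map Crossing); apply: H; lia.
Qed.

Lemma strips_labels (ss : seq (seq bool)) i f t :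
  all (fun s => s != [::]) ss -> (t < size ss)%N ->
  (i + t).+1.*2 \in edge_labels (strips i f (crossings ss)).
Proof.
elim: ss i f t => // s ss IH i f [|t] /= /andP[ns nss] tss;
  rewrite /edge_labels map_cat flatten_cat mem_cat.
  by rewrite addn0; case: s ns => [|b [|b2 s]] //= _; rewrite inE eqxx.
by rewrite -addSnnS IH ?orbT.
Qed.

(* The colours are constant outside the part between columns [i] and [j]. *)
Lemma split_flat_colorable (A : comNzRingType) (ss : seq (seq bool)) i j :
  all (fun s => s != [::]) ss -> (i < j)%N -> (j < size ss)%N ->
  (net (nth [::] ss i))%:~R = 0 :> A -> (net (nth [::] ss j))%:~R = 0 :> A ->
  colorable (@flat A) (strip_pretzel (crossings ss)).
Proof.
move=> nss ij jss neti netj.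
(* Edges [2 t] and [2 t + 1] lie just left of column [t]. The colour is 1 between columns [i] and
   [j] and 0 elsewhere, in particular at the vertex; only these two columns see a horizontal
   difference, and their net twists vanish in [A]. *)
pose c0 e : A := (i < e./2 <= j)%N%:R.
have [] := @strips_extend A (@flat A) ss 0 (size ss).*2.+2 c0 nss; first by [].
  move=> t tss d; rewrite add0n in d *.
  have -> : d = 0.
    rewrite /d /c0 !doubleK; have [->|ti] := eqVneq t i; first by rewrite neti mul0r.
    have [->|tj] := eqVneq t j; first by rewrite netj mul0r.
    have -> : (i < t.+1 <= j)%N = (i < t <= j)%N by lia.
    by rewrite subrr mulr0.
  by rewrite !addr0 /c0 /= !uphalf_double !doubleK.
move=> c clt col; exists c.
  rewrite /strip_pretzel coloring_cons; split; last by rewrite size_map.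
  rewrite /colored_node /= size_map !clt; try lia.
  rewrite /c0 /= !uphalf_double !doubleK.
  have -> : (i < size ss <= j)%N = false by lia.
  by rewrite !subrr !addr0.
case=> K HK; have : c 0%N = c i.+1.*2.
  rewrite !HK // /strip_pretzel edge_labels_cons mem_cat inE ?eqxx //.
  by rewrite (@strips_labels ss 0 _ i) ?orbT // (ltn_trans ij).
by rewrite !clt ?/c0 ?doubleK ?ltnSn ?ij //; [move/esym/eqP; rewrite oner_eq0 | lia].
Qed.

Local Close Scope ring_scope.

(** * Simplification of pretzel diagrams *)

Lemma equivalent_refl Q : equivalent Q Q.
Proof. exact: rt_refl. Qed.

Lemma equivalent_trans Q Q' Q'' :
  equivalent Q Q' -> equivalent Q' Q'' -> equivalent Q Q''.
Proof. exact: rt_trans. Qed.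

Lemma equivalent_perm Q Q' : perm_eq Q Q' -> equivalent Q Q'.
Proof. by move=> pQ; apply: rt_step; left; left; apply: same_perm. Qed.

Lemma equivalent_reidemeister Q Q' : reidemeister Q Q' -> equivalent Q Q'.
Proof. by move=> moveQ; apply: rt_step; left; right. Qed.

(** [same_rotate] acts on the head of the code, so the node is moved there and back. *)
Lemma equivalent_rotate n Q x Q' :
  equivalent (Q ++ x :: Q') (Q ++ iter n rotate x :: Q').
Proof.
elim: n => [|n IH]; first exact: equivalent_refl.
apply: equivalent_trans IH _; rewrite iterS; move: (iter n rotate x) => y.
apply: (@equivalent_trans _ (y :: Q ++ Q')).
  by apply: equivalent_perm; rewrite perm_sym -[_ ++ y :: _]cat_rcons -cat_cons perm_cat2r
    perm_sym perm_rcons.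
apply: (@equivalent_trans _ (rotate y :: Q ++ Q')).
  by apply: rt_step; left; left; apply: same_rotate.
by apply: equivalent_perm; rewrite -[_ ++ rotate y :: _]cat_rcons -cat_cons perm_cat2r
  perm_sym perm_rcons.
Qed.

Lemma relabel_cons h k a b c d Q :
  relabel h (Node k a b c d :: Q) = Node k (h a) (h b) (h c) (h d) :: relabel h Q.
Proof. by congr (_ :: _); apply: relabel_Node. Qed.

Lemma is_twist_relabel h s l r l' r' Q :
  is_twist s l r l' r' Q -> is_twist s (h l) (h r) (h l') (h r') (relabel h Q).
Proof.
elim: s l r Q => [|b s IH] l r Q /=; first by case=> -> -> ->.
case=> f [g [Q' [-> /IH tw]]]; exists (h f), (h g), (relabel h Q'); split=> //.
by congr (_ :: _); apply: relabel_Node.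
Qed.

Lemma is_twists_relabel h ss a a' z z' Q :
  is_twists ss a a' z z' Q -> is_twists ss (h a) (h a') (h z) (h z') (relabel h Q).
Proof.
elim: ss a a' Q => [|s ss IH] a a' Q /=; first by case=> -> -> ->.
case=> b [b' [Q1 [Q2 [-> /(is_twist_relabel h) tw /IH tws]]]].
by do 4!eexists; split; [apply: map_cat | exact: tw | exact: tws].
Qed.

Lemma is_twist_cat s1 s2 l r l' r' Q :
  is_twist (s1 ++ s2) l r l' r' Q <->
  exists f g Q1 Q2, [/\ Q = Q1 ++ Q2, is_twist s1 l r f g Q1 & is_twist s2 f g l' r' Q2].
Proof.
elim: s1 l r Q => [|b s1 IH] l r Q /=; split.
- by move=> tw; exists l, r, [::], Q.
- by case=> f [g [Q1 [Q2 [-> [-> -> ->]]]]].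
- case=> f [g [Q' [-> /IH[f' [g' [Q1 [Q2 [-> tw1 tw2]]]]]]]].
  by exists f', g', (Node (Crossing b) r l f g :: Q1), Q2; split=> //; exists f, g, Q1.
- case=> f' [g' [Q1 [Q2 [-> [f [g [Q1' [-> tw1]]]] tw2]]]].
  by exists f, g, (Q1' ++ Q2); split=> //; apply/IH; exists f', g', Q1', Q2.
Qed.

Lemma is_twists_cat ss1 ss2 a a' z z' Q :
  is_twists (ss1 ++ ss2) a a' z z' Q <->
  exists b b' Q1 Q2, [/\ Q = Q1 ++ Q2, is_twists ss1 a a' b b' Q1 &
                         is_twists ss2 b b' z z' Q2].
Proof.
elim: ss1 a a' Q => [|s ss1 IH] a a' Q /=; split.
- by move=> tw; exists a, a', [::], Q.
- by case=> b [b' [Q1 [Q2 [-> [-> -> ->]]]]].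
- case=> b [b' [Q1 [Q' [-> tw /IH[c [c' [Q2 [Q3 [-> tw2 tw3]]]]]]]]].
  exists c, c', (Q1 ++ Q2), Q3; rewrite catA; split=> //.
  by exists b, b', Q1, Q2.
- case=> c [c' [Q12 [Q3 [-> [b [b' [Q1 [Q2 [-> tw1 tw2]]]]] tw3]]]].
  exists b, b', Q1, (Q2 ++ Q3); rewrite catA; split=> //.
  by apply/IH; exists c, c', Q2, Q3.
Qed.

(** Consecutive opposite crossings of a column bound a bigon with sides [f] and [g]; RII joins [r]
    to [g'] and [l] to [f']. *)
Lemma cancel_vertical ss1 s1 b s2 ss2 Q :
  is_pretzel (ss1 ++ (s1 ++ [:: b, ~~ b & s2]) :: ss2) Q ->
  exists2 Q', equivalent Q Q' & is_pretzel (ss1 ++ (s1 ++ s2) :: ss2) Q'.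
Proof.
case=> a [a' [z [z' [Q0 [pQ /is_twists_cat[c [c' [Q1 [Q2 [EQ0 tw1]]]]]]]]]] /=.
case=> d [d' [Q3 [Q4 [EQ2 /is_twist_cat[l [r [Q5 [Q6 [EQ3 tw5 tw6]]]]] tw4]]]].
case: tw6 EQ3 => f [g [_ [-> [f' [g' [Q7 [-> tw7]]]]]]] EQ3.
pose h := bigon_join r l g' f'.
have [hr hl] := bigon_join_eq r l g' f'; rewrite -/h in hr hl.
pose Rest := Node Vertex a z z' a' :: Q1 ++ Q5 ++ Q7 ++ Q4.
exists (relabel h Rest).
  apply: (@equivalent_trans _
      [:: Node (Crossing b) r l f g, Node (Crossing (~~ b)) g f f' g' & Rest]).
    apply: equivalent_perm; apply: perm_trans pQ _; rewrite EQ0 EQ2 EQ3 /Rest.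
    by apply/permP => P; rewrite /= !count_cat /= ?count_cat; ring.
  (* Three quarter-turns bring each of the two crossings into the form required by RII; an odd
     number of turns exchanges the crossing types. *)
  apply: equivalent_trans (equivalent_rotate 3 [::] _ _) _.
  apply: equivalent_trans
    (equivalent_rotate 3 [:: iter 3 rotate (Node (Crossing b) r l f g)] _ _) _.
  rewrite /= !rotate_Node /= !negbK; apply: equivalent_reidemeister.
  by have := RII (~~ b) r f g' l g f' Rest; rewrite negbK.
exists (h a), (h a'), (h z), (h z'), (relabel h (Q1 ++ Q5 ++ Q7 ++ Q4)); split.
  by rewrite relabel_cons perm_refl.
apply/is_twists_cat; exists (h c), (h c'), (relabel h Q1), (relabel h (Q5 ++ Q7 ++ Q4)); split.
- by rewrite /relabel map_cat.
- exact: is_twists_relabel.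
exists (h d), (h d'), (relabel h (Q5 ++ Q7)), (relabel h Q4); split.
- by rewrite /relabel catA map_cat.
- apply/is_twist_cat; exists (h l), (h r), (relabel h Q5), (relabel h Q7); split.
  + by rewrite /relabel map_cat.
  + exact: is_twist_relabel.
  + by rewrite hl hr; apply: is_twist_relabel.
- exact: is_twists_relabel.
Qed.

(** Adjacent one-crossing columns of opposite type bound a bigon with sides [m] and [m'], already in
    the form required by RII. *)
Lemma cancel_horizontal ss1 b ss2 Q :
  is_pretzel (ss1 ++ [:: [:: b], [:: ~~ b] & ss2]) Q ->
  exists2 Q', equivalent Q Q' & is_pretzel (ss1 ++ ss2) Q'.
Proof.
case=> a [a' [z [z' [Q0 [pQ /is_twists_cat[l [l' [Q1 [Q2 [EQ0 tw1]]]]]]]]]] /=.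
case=> m [m' [T1 [Q3 [EQ2 [f1 [g1 [T1' [ET1 [ET1' Ef1 Eg1]]]]]]]]].
case=> r [r' [T2 [Q4 [EQ3 [f2 [g2 [T2' [ET2 [ET2' Ef2 Eg2]]]]]]]]] tw4.
rewrite {}ET1' -{}Ef1 -{}Eg1 in ET1; rewrite {}ET2' -{}Ef2 -{}Eg2 in ET2.
pose h := bigon_join l l' r r'.
have [hl hl'] := bigon_join_eq l l' r r'; rewrite -/h in hl hl'.
pose Rest := Node Vertex a z z' a' :: Q1 ++ Q4.
exists (relabel h Rest).
  apply: (@equivalent_trans _
    ([:: Node (Crossing b) m l l' m', Node (Crossing (~~ b)) r m m' r' & Rest])).
    apply: equivalent_perm; apply: perm_trans pQ _; rewrite EQ0 EQ2 EQ3 ET1 ET2 /Rest.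
    by apply/permP => P; rewrite /= !count_cat /= ?count_cat; ring.
  exact/equivalent_reidemeister/RII.
exists (h a), (h a'), (h z), (h z'), (relabel h (Q1 ++ Q4)); split.
  by rewrite relabel_cons perm_refl.
apply/is_twists_cat; exists (h l), (h l'), (relabel h Q1), (relabel h Q4); split.
- by rewrite /relabel map_cat.
- exact: is_twists_relabel.
- by rewrite hl hl'; apply: is_twists_relabel.
Qed.

(** The empty column joins the two right corners of the crossing, which becomes a kink for RI. *)
Lemma untwist_left ss1 b ss2 Q :
  is_pretzel (ss1 ++ [:: [:: b], [::] & ss2]) Q ->
  exists2 Q', equivalent Q Q' & is_pretzel (ss1 ++ [::] :: ss2) Q'.
Proof.
case=> a [a' [z [z' [Q0 [pQ /is_twists_cat[l [l' [Q1 [Q2 [EQ0 tw1]]]]]]]]]] /=.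
case=> m [m' [T1 [Q3 [EQ2 [f1 [g1 [T1' [ET1 [ET1' Ef1 Eg1]]]]]]]]].
case=> r [r' [T2 [Q4 [EQ3 [ET2 Em Er]] tw4]]].
rewrite {}ET1' -{}Ef1 -{}Eg1 {}Em in ET1; rewrite {}Er in tw4.
pose h := rename l' l.
have hl : h l' = h l by rewrite /h /rename eqxx; case: eqP.
pose Rest := Node Vertex a z z' a' :: Q1 ++ Q4.
exists (relabel h Rest).
  apply: (@equivalent_trans _ (Node (Crossing b) m l l' m :: Rest)).
    apply: equivalent_perm; apply: perm_trans pQ _; rewrite EQ0 EQ2 EQ3 ET1 ET2 /Rest.
    by apply/permP => P; rewrite /= !count_cat /= ?count_cat; ring.
  apply: equivalent_trans (equivalent_rotate 3 [::] _ _) _.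
  rewrite /= !rotate_Node /= !negbK; exact/equivalent_reidemeister/RI.
exists (h a), (h a'), (h z), (h z'), (relabel h (Q1 ++ Q4)); split.
  by rewrite relabel_cons perm_refl.
apply/is_twists_cat; exists (h l), (h l'), (relabel h Q1), (relabel h Q4); split.
- by rewrite /relabel map_cat.
- exact: is_twists_relabel.
exists (h r), (h r), [::], (relabel h Q4); split=> //.
exact: is_twists_relabel.
Qed.

Lemma untwist_right ss1 b ss2 Q :
  is_pretzel (ss1 ++ [:: [::], [:: b] & ss2]) Q ->
  exists2 Q', equivalent Q Q' & is_pretzel (ss1 ++ [::] :: ss2) Q'.
Proof.
case=> a [a' [z [z' [Q0 [pQ /is_twists_cat[l [l' [Q1 [Q2 [EQ0 tw1]]]]]]]]]] /=.
case=> m [m' [T1 [Q3 [EQ2 [ET1 El Em]]]]].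
case=> r [r' [T2 [Q4 [EQ3 [f2 [g2 [T2' [ET2 [ET2' Ef2 Eg2]]]]]]]]] tw4.
rewrite {}ET2' -{}Ef2 -{}Eg2 {}Em in ET2; rewrite {}El in tw1.
pose h := rename r r'.
have hr : h r = h r' by rewrite /h /rename eqxx; case: eqP.
pose Rest := Node Vertex a z z' a' :: Q1 ++ Q4.
exists (relabel h Rest).
  apply: (@equivalent_trans _ (Node (Crossing b) r m m r' :: Rest)).
    apply: equivalent_perm; apply: perm_trans pQ _; rewrite EQ0 EQ2 EQ3 ET1 ET2 /Rest.
    by apply/permP => P; rewrite /= !count_cat /= ?count_cat; ring.
  apply: equivalent_trans (equivalent_rotate 1 [::] _ _) _.
  rewrite /= !rotate_Node /=; exact/equivalent_reidemeister/RI.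
exists (h a), (h a'), (h z), (h z'), (relabel h (Q1 ++ Q4)); split.
  by rewrite relabel_cons perm_refl.
apply/is_twists_cat; exists (h l), (h l), (relabel h Q1), (relabel h Q4); split.
- by rewrite /relabel map_cat.
- exact: is_twists_relabel.
exists (h r'), (h r'), [::], (relabel h Q4); split=> //.
by rewrite -{1}hr; apply: is_twists_relabel.
Qed.

Lemma constant_or_alternation (s : seq bool) :
  (exists b, s = nseq (size s) b) \/
  exists b s1 s2, s = s1 ++ [:: b, ~~ b & s2].
Proof.
elim: s => [|b s [[b' ->]|[b' [s1 [s2 ->]]]]]; first by left; exists true.
- rewrite /= size_nseq; case: (size s) => [|n]; first by left; exists b.
  have [->|nb] := eqVneq b b'; first by left; exists b'.
  by right; exists b, [::], (nseq n b'); rewrite /=; case: b b' nb => [] [].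
- by right; exists b', (b :: s1), s2.
Qed.

(** Cancelling opposite neighbours leaves a constant word, which has at most one letter if its net
    twist is at most 1. The property [P] allows the same argument for the crossings of a column and
    for a row of one-crossing columns. *)
Lemma cancel_to_constant (P : seq bool -> pseudodiagram -> Prop) s Q :
  (forall b s1 s2 Q, P (s1 ++ [:: b, ~~ b & s2]) Q ->
     exists2 Q', equivalent Q Q' & P (s1 ++ s2) Q') ->
  P s Q -> (`|net s| <= 1)%R ->
  exists t Q', [/\ equivalent Q Q', P t Q', size t <= 1 & net t = net s].
Proof.
move=> cancel; have [n] := ubnP (size s).
elim: n s Q => // n IH s Q; rewrite ltnS => sn PQ net1.
have [[b Es]|[b [s1 [s2 Es]]]] := constant_or_alternation s.
  exists s, Q; split=> //; first exact: equivalent_refl.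
  move: net1; rewrite Es net_nseq size_nseq.
  by case: b {Es}; rewrite /= ?expr0 ?expr1; lia.
rewrite Es in PQ; have [Q1 RQ1 PQ1] := cancel _ _ _ _ PQ.
have net12 : net (s1 ++ s2) = net s.
  by rewrite Es !net_cat !net_cons; case: b {Es PQ}; rewrite /= ?expr0 ?expr1; lia.
have [||t [Q2 [RQ2 PQ2 t1 tnet]]] := IH _ _ _ PQ1.
- by rewrite Es !size_cat /= in sn; rewrite size_cat; lia.
- by rewrite net12.
by exists t, Q2; split=> //; [apply: equivalent_trans RQ1 RQ2 | rewrite tnet].
Qed.

(** [ss1] holds the columns already treated, so that the induction can run from left to right. *)
Lemma untwist_columns ss1 ss2 Q :
  is_pretzel (ss1 ++ ss2) Q -> all (fun s => `|net s| <= 1)%R ss2 ->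
  exists ts Q', [/\ equivalent Q Q', is_pretzel (ss1 ++ ts) Q',
    all (fun t => size t <= 1) ts & map net ts = map net ss2].
Proof.
elim: ss2 ss1 Q => [|s ss2 IH] ss1 Q.
  by move=> prQ _; exists [::], Q; split=> //; apply: equivalent_refl.
move=> prQ /= /andP[s1 all1].
have [b s' s'' Q' prQ'|t [Q1 [eQ1 prQ1 t1 tnet]]] :=
  @cancel_to_constant (fun s => is_pretzel (ss1 ++ s :: ss2)) s Q _ prQ s1.
  exact: cancel_vertical prQ'.
rewrite -cat_rcons in prQ1.
have [ts [Q2 [eQ2 prQ2 ts1 tsnet]]] := IH _ _ prQ1 all1.
exists (t :: ts), Q2; rewrite /= t1 tnet tsnet; split=> //.
  exact: equivalent_trans eQ1 eQ2.
by rewrite -cat_rcons.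
Qed.

Lemma untwist_row s Q :
  is_pretzel [seq [:: b] | b <- s] Q -> (`|net s| <= 1)%R ->
  exists t Q', [/\ equivalent Q Q', is_pretzel [seq [:: b] | b <- t] Q' & size t <= 1].
Proof.
move=> prQ s1.
have [b s' s'' Q' prQ'|t [Q1 [eQ1 prQ1 t1 _]]] :=
  @cancel_to_constant (fun s => is_pretzel [seq [:: b] | b <- s]) s Q _ prQ s1.
  rewrite map_cat; rewrite map_cat /= in prQ'; exact: cancel_horizontal prQ'.
by exists t, Q1.
Qed.

(** The empty column absorbs its neighbours one by one, first those on its right and then those on
    its left. *)
Lemma collapse_columns s1 s2 Q :
  is_pretzel ([seq [:: b] | b <- s1] ++ [::] :: [seq [:: b] | b <- s2]) Q ->
  exists2 Q', equivalent Q Q' & is_pretzel [:: [::]] Q'.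
Proof.
elim: s2 Q => [|b s2 IH] Q.
  elim/last_ind: s1 Q => [|s1 b IH] Q.
    by exists Q => //; apply: equivalent_refl.
  rewrite map_rcons cat_rcons => /untwist_left[Q1 eQ1 /IH[Q2 eQ2 prQ2]].
  by exists Q2 => //; apply: equivalent_trans eQ1 eQ2.
move=> /= /untwist_right[Q1 eQ1 /IH[Q2 eQ2 prQ2]].
by exists Q2 => //; apply: equivalent_trans eQ1 eQ2.
Qed.

(** * Recognising the trivial diagrams *)

Lemma equivalent_relabel f Q Q' :
  perm_eq (relabel f Q) Q' -> {in edge_labels Q &, injective f} -> equivalent Q Q'.
Proof.
move=> pQ injf; apply: equivalent_trans (equivalent_perm pQ).
by apply: rt_step; left; left; apply: same_relabel.
Qed.

(** Positions in a list of labels serve as the renaming to the labels 0, 1, 2, 3 of the standard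
    codes. *)
Lemma index_injective (s : seq nat) : {in s &, injective (index^~ s)}.
Proof. by move=> x y xs ys E; rewrite -(nth_index 0 xs) E nth_index. Qed.

(** The vertex reads [a a a' a'], and [a] differs from [a'] because no label occurs four times. *)
Lemma no_column_trivial Q : regular Q -> is_pretzel [::] Q -> trivial_diagram Q.
Proof.
case=> pairQ _ _ [a [a' [z [z' [Q0 [pQ [EQ0 Ez Ez']]]]]]]; left.
rewrite {}EQ0 {}Ez {}Ez' in pQ.
have /(_ a) := paired_perm (perm_edge_labels pQ) pairQ.
rewrite /edge_labels /= eqxx; have [_|/negPf na _] := eqVneq a' a; first by case.
apply: equivalent_trans (equivalent_perm pQ) _.
apply: (@equivalent_relabel (index^~ [:: a; a'])).
  by rewrite relabel_cons /= !eqxx eq_sym na.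
by apply: sub_in2 (@index_injective _) => x; rewrite /edge_labels /= !inE; do 2!case: (x == _).
Qed.

Lemma empty_column_trivial Q : regular Q -> is_pretzel [:: [::]] Q -> trivial_diagram Q.
Proof.
case=> pairQ _ _ [a [a' [z [z' [Q0 [pQ [b [b' [Q1 [Q2]]]]]]]]]].
case=> EQ0 [EQ1 Ea Eb] [EQ2 Ez Ez']; left.
rewrite {}EQ0 {}EQ1 {}EQ2 {}Ez {}Ez' {}Ea {}Eb in pQ.
have /(_ a) := paired_perm (perm_edge_labels pQ) pairQ.
rewrite /edge_labels /= eqxx; have [_|/negPf na _] := eqVneq b a; first by case.
apply: equivalent_trans (equivalent_perm pQ) _.
apply: equivalent_trans (equivalent_rotate 3 [::] _ _) _.
rewrite /= !rotate_Node; apply: (@equivalent_relabel (index^~ [:: a; b])).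
  by rewrite relabel_cons /= !eqxx eq_sym na.
by apply: sub_in2 (@index_injective _) => x; rewrite /edge_labels /= !inE; do 2!case: (x == _).
Qed.

Lemma single_crossing_trivial b Q : regular Q -> is_pretzel [:: [:: b]] Q -> trivial_diagram Q.
Proof.
case=> pairQ _ _ [a [a' [z [z' [Q0 [pQ [c [c' [Q1 [Q2]]]]]]]]]].
case=> EQ0 [f [g [Q3 [EQ1 [EQ3 Ef Eg]]]]] [EQ2 Ez Ez']; right.
rewrite {}EQ0 {}EQ1 {}EQ2 {}EQ3 -{}Ef -{}Eg -{}Ez -{}Ez' in pQ.
have pair4 := paired_perm (perm_edge_labels pQ) pairQ.
have na : a \notin [:: z; z; z'; z'; a'; a'] by apply: paired_fresh pair4 _; label_perm.
have nz : z \notin [:: a; a; z'; z'; a'; a'] by apply: paired_fresh pair4 _; label_perm.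
have nz' : z' \notin [:: z; z; a; a; a'; a'] by apply: paired_fresh pair4 _; label_perm.
move: na nz nz'; fresh_facts => na; fresh_facts => nz; fresh_facts => nz'.
apply: equivalent_trans (equivalent_perm pQ) _; rewrite /=.
case: b {pQ pair4}.
  apply: equivalent_trans (equivalent_rotate 2 [:: _] _ _) _.
  rewrite /= !rotate_Node /=.
  apply: (@equivalent_relabel (index^~ [:: a; z; z'; a'])).
    by rewrite !relabel_cons /=; fresh_simpl.
  apply: sub_in2 (@index_injective _) => x; rewrite /edge_labels /= !inE.
  by do 4!case: (x == _).
(* For the other type of crossing, a quarter-turn of both codes again leads to [trivial_L]. *)
apply: equivalent_trans (equivalent_rotate 1 [::] _ _) _.
apply: equivalent_trans (equivalent_rotate 1 [:: _] _ _) _.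
rewrite /= !rotate_Node /=.
apply: (@equivalent_relabel (index^~ [:: z; z'; a'; a])).
  by rewrite !relabel_cons /=; fresh_simpl.
apply: sub_in2 (@index_injective _) => x; rewrite /edge_labels /= !inE.
by do 4!case: (x == _).
Qed.

Lemma equivalent_trivial Q Q' :
  equivalent Q Q' -> trivial_diagram Q' -> trivial_diagram Q.
Proof. by move=> eQ [] eQ'; [left | right]; apply: equivalent_trans eQ eQ'. Qed.

Lemma settled_singletons (ts : seq (seq bool)) :
  all (fun t => size t <= 1) ts -> all (fun t => net t != 0%R) ts ->
  exists s, ts = [seq [:: b] | b <- s] /\ net s = (\sum_(t <- ts) net t)%R.
Proof.
elim: ts => [|t ts IH] /=; first by exists [::]; rewrite big_nil net_nil.
case/andP=> t1 /IH{}IH /andP[t0 /IH[s [-> Es]]].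
case: t t1 t0 => [|b [|]] //= _; first by rewrite net_nil eqxx.
by move=> _; exists (b :: s); rewrite big_cons net_cons -Es net_cons net_nil addr0.
Qed.

(** Cancelling inside the columns leaves one crossing in each; cancelling between columns then
    leaves at most one column. *)
Lemma narrow_trivial ss Q :
  regular Q -> is_pretzel ss Q ->
  all (fun s => (`|net s| <= 1) && (net s != 0))%R ss ->
  (`|\sum_(s <- ss) net s| <= 1)%R -> trivial_diagram Q.
Proof.
move=> regQ prQ; rewrite all_predI => /andP[all1 all0] sum1.
have [ts [Q1 [eQ1 prQ1 ts1 tsnet]]] := @untwist_columns [::] ss Q prQ all1.
have [|s [Es snet]] := settled_singletons ts1.
  by rewrite -(all_map net (predC1 0%R)) tsnet all_map.
have [||t [Q2 [eQ2 prQ2 t1]]] := @untwist_row s Q1; first by rewrite -Es.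
  by rewrite snet -(big_map net xpredT id) tsnet big_map.
apply: equivalent_trivial (equivalent_trans eQ1 eQ2) _.
have [regQ2 _] := equivalent_regular (equivalent_trans eQ1 eQ2) regQ.
by case: t t1 prQ2 => [|b [|]] //= _; [apply: no_column_trivial | apply: single_crossing_trivial].
Qed.

(** The column of net twist 0 becomes empty and, once the others are single crossings, absorbs
    them. *)
Lemma split_trivial ss1 ss s2 Q :
  regular Q -> is_pretzel (ss1 ++ ss :: s2) Q -> net ss = 0%R ->
  all (fun s => (`|net s| <= 1) && (net s != 0))%R (ss1 ++ s2) -> trivial_diagram Q.
Proof.
move=> regQ prQ net0; rewrite all_predI => /andP[all1 all0].
have [|ts [Q1 [eQ1 prQ1 ts1 tsnet]]] := @untwist_columns [::] _ Q prQ.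
  by move: all1; rewrite !all_cat /= net0.
have [t1 [t [t2 [Ets n1 n0 n2]]]] : exists t1 t t2, [/\ ts = t1 ++ t :: t2,
    map net t1 = map net ss1, net t = 0%R & map net t2 = map net s2].
  rewrite map_cat in tsnet.
  exists (take (size ss1) ts), (nth [::] ts (size ss1)), (drop (size ss1).+1 ts).
  have sz : size ss1 < size ts.
    by rewrite -[size ts](size_map net) tsnet size_cat !size_map /=; lia.
  split; first by rewrite -drop_nth ?cat_take_drop.
  - by rewrite map_take tsnet take_size_cat // size_map.
  - by rewrite -(nth_map _ 0%R) // tsnet nth_cat size_map ltnn subnn.
  - by rewrite map_drop tsnet drop_cat size_map ltnNge leqnSn /= subSnn /= drop0.
move: ts1; rewrite Ets all_cat /= => /and3P[sz1 sz sz2].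
have Et : t = [::] by case: t sz n0 {Ets} => [|[] [|]] //=; rewrite net_cons net_nil.
move: all0; rewrite all_cat -!(all_map net (predC1 0%R)) -n1 -n2 !all_map => /andP[nz1 nz2].
have [u1 [E1 _]] := settled_singletons sz1 nz1.
have [u2 [E2 _]] := settled_singletons sz2 nz2.
rewrite Ets E1 E2 Et in prQ1; have [Q2 eQ2 prQ2] := collapse_columns prQ1.
apply: equivalent_trivial (equivalent_trans eQ1 eQ2) _.
have [regQ2 _] := equivalent_regular (equivalent_trans eQ1 eQ2) regQ.
exact: empty_column_trivial.
Qed.

(** * Choosing resolutions *)

Definition resolves (ks : seq kind) (s : seq bool) : bool :=
  all2 kind_refines ks [seq Crossing b | b <- s].

Definition fixed (ks : seq kind) : nat := count (predC1 Precrossing) ks.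

Lemma all2_map_r (T U V : Type) (r : T -> U -> bool) (f : V -> U) s t :
  all2 r s (map f t) = all2 (fun x y => r x (f y)) s t.
Proof. by elim: s t => [|x s IH] [|y t] //=; rewrite IH. Qed.

Lemma crossings_refine kss ss :
  all2 (all2 kind_refines) kss (crossings ss) = all2 resolves kss ss.
Proof. exact: all2_map_r. Qed.

Lemma kind_refines_vertexF k k' : kind_refines k k' -> k != Vertex -> k' != Vertex.
Proof. by rewrite /kind_refines => /orP[/eqP->|/andP[]]. Qed.

Lemma all2_refines_vertexF kss kss' :
  all2 (all2 kind_refines) kss kss' -> all (all (predC1 Vertex)) kss ->
  all (all (predC1 Vertex)) kss'.
Proof.
elim: kss kss' => [|ks kss IH] [|ks' kss'] //= /andP[kk /IH{}IH] /andP[ksV /IH->].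
rewrite andbT; elim: ks ks' kk ksV => [|k ks IHk] [|k' ks'] //=.
by case/andP=> /kind_refines_vertexF H /IHk{}IHk /andP[/H-> /IHk].
Qed.

Lemma resolution_crossings kss D :
  all (all (predC1 Vertex)) kss -> resolution (strip_pretzel kss) D ->
  exists2 ss, D = strip_pretzel (crossings ss) & all2 resolves kss ss.
Proof.
move=> kssV [/strip_pretzel_refined[kss' ED kk] pre0]; rewrite ED in pre0.
have [ss Ess] := precrossings_all_crossings (all2_refines_vertexF kk kssV) pre0.
by exists ss; rewrite ?ED ?Ess // -crossings_refine /crossings -Ess.
Qed.

Lemma crossings_resolution kss ss :
  all2 resolves kss ss ->
  resolution (strip_pretzel kss) (strip_pretzel (crossings ss)).
Proof.
rewrite -crossings_refine => kk; split; first exact: strip_pretzel_refines.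
rewrite precrossings_strip_pretzel; elim: ss {kk} => //= s ss IH.
by rewrite count_cat IH addn0 count_map; elim: s.
Qed.

Lemma resolves_size ks s : resolves ks s -> size s = size ks.
Proof. by move/all2_size; rewrite size_map. Qed.

Local Open Scope ring_scope.

Lemma net_parity s : odd `|net s|%N = odd (size s).
Proof.
elim: s => [|b s IH]; first by rewrite net_nil.
by rewrite net_cons /= -IH; case: b; rewrite /= ?expr0 ?expr1; lia.
Qed.

(** Each fixed positive crossing contributes 1, and any other double point at least -1. *)
Lemma net_resolved_ge ks s :
  resolves ks s -> (count_mem (Crossing true) ks).*2%:Z - (size ks)%:Z <= net s.
Proof.
elim: ks s => [|k ks IH] [|b s] //=; first by rewrite net_nil.
rewrite /resolves /= => /andP[kb /IH{}IH]; rewrite net_cons.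
have := IH; case: k kb => [||[]]; case: b => //= _; rewrite ?expr0 ?expr1; lia.
Qed.

(** [v] is the number of precrossings resolved to [Crossing false]; each lowers the largest possible
    net twist by 2. *)
Lemma resolve_net ks v :
  all (predC1 Vertex) ks -> (v <= count_mem Precrossing ks)%N ->
  exists2 s, resolves ks s & net s = (count_mem (Crossing true) ks)%:Z -
    (count_mem (Crossing false) ks)%:Z + (count_mem Precrossing ks)%:Z - v.*2%:Z.
Proof.
elim: ks v => [|k ks IH] v /=; first by case: v => // _ _; exists [::]; rewrite ?net_nil.
case/andP=> kV ksV; case: k kV => [//||b] _ /= vle.
  case: v vle => [|v] vle.
    have [//|//|s Hs netE] := IH 0%N; exists (true :: s) => //.
    by rewrite net_cons netE /= expr0; lia.
  have [//|//|s Hs netE] := IH v; exists (false :: s) => //.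
  by rewrite net_cons netE /= expr1; lia.
have [//|//|s Hs netE] := IH v; exists (b :: s).
  by rewrite /resolves /= /kind_refines eqxx.
by rewrite net_cons netE; case: b; rewrite /= ?expr0 ?expr1; lia.
Qed.

Lemma kind_counts ks : all (predC1 Vertex) ks ->
  size ks = (count_mem (Crossing true) ks + count_mem (Crossing false) ks +
    count_mem Precrossing ks)%N /\
  fixed ks = (count_mem (Crossing true) ks + count_mem (Crossing false) ks)%N.
Proof.
rewrite /fixed; elim: ks => //= k ks IH /andP[kV /IH[-> ->]].
by case: k kV => [||[]] //= _; lia.
Qed.

Lemma resolve_zero ks :
  all (predC1 Vertex) ks -> ~~ odd (size ks) -> ((fixed ks).*2 <= size ks)%N ->
  exists2 s, resolves ks s & net s = 0.
Proof.
move=> ksV; have [-> ->] := kind_counts ksV; move: (@resolve_net ks).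
set p := count_mem (Crossing true) ks; set q := count_mem (Crossing false) ks.
set u := count_mem Precrossing ks => H ev le.
(* The solution of [p - q + u - 2 v = 0]; it lies between 0 and [u] since [p + q <= u]. *)
have [||s Hs netE] := H (p + u - q)./2 => //; first lia.
by exists s => //; rewrite netE; lia.
Qed.

Lemma resolve_one ks :
  all (predC1 Vertex) ks -> odd (size ks) -> ((fixed ks).*2 <= (size ks).+1)%N ->
  exists2 s, resolves ks s & `|net s| = 1.
Proof.
move=> ksV; have [-> ->] := kind_counts ksV; move: (@resolve_net ks).
set p := count_mem (Crossing true) ks; set q := count_mem (Crossing false) ks.
set u := count_mem Precrossing ks => H ev le.
(* Here [p + q <= u + 1]. If [q <= u], halving an odd number leaves net twist 1; if [q = u + 1],
   then [p = 0], the truncated subtraction gives [v = 0], and the net twist is -1. *)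
have [||s Hs netE] := H (p + u - q)./2 => //; first lia.
by exists s => //; rewrite netE; lia.
Qed.

Lemma resolve_sign ks (e : bool) :
  all (predC1 Vertex) ks -> odd (size ks) -> ((fixed ks).*2 < size ks)%N ->
  exists2 s, resolves ks s & net s = (-1) ^+ e.
Proof.
move=> ksV; have [-> ->] := kind_counts ksV; move: (@resolve_net ks).
set p := count_mem (Crossing true) ks; set q := count_mem (Crossing false) ks.
set u := count_mem Precrossing ks => H ev le.
have [||s Hs netE] := H ((p + u - q)./2 + e)%N => //; first by case: e; lia.
by exists s => //; rewrite netE; case: e {netE}; rewrite ?expr0 ?expr1; lia.
Qed.

(* A column is forced when its fixed crossings may leave only one sign. *)
Definition forced (ks : seq kind) : bool := (size ks < (fixed ks).*2)%N.

(** [c] is the total net twist of the forced columns, whose signs are not controlled. Of the other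
    columns, [v] are resolved to -1 and the rest to 1. *)
Lemma resolve_row_shifted kss :
  all (all (predC1 Vertex)) kss -> all (fun ks => odd (size ks)) kss ->
  all (fun ks => (fixed ks).*2 <= (size ks).+1)%N kss ->
  exists2 c : int, `|c| <= (count forced kss)%:Z &
    forall v, (v <= count (predC forced) kss)%N ->
    exists ss, [/\ all2 resolves kss ss, all (fun s => `|net s| == 1) ss &
      \sum_(s <- ss) net s = c + (count (predC forced) kss)%:Z - v.*2%:Z].
Proof.
elim: kss => [_ _ _|ks kss IH] /=.
  exists 0 => // v; rewrite leqn0 => /eqP->; exists [::]; split=> //.
  by rewrite big_nil.
case/andP=> ksV kssV /andP[ks_odd kss_odd] /andP[ks_le kss_le].
have [c c_le Hc] := IH kssV kss_odd kss_le.
case: (boolP (forced ks)) => [frc|nfrc] /=.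
  have [s Hs net1] := resolve_one ksV ks_odd ks_le.
  exists (net s + c); first by move: c_le net1; clear; lia.
  move=> v /Hc[ss [Hss nets sumE]]; exists (s :: ss).
  split; rewrite /= ?Hs ?Hss ?net1 ?nets // big_cons sumE; clear; lia.
exists c; first by rewrite add0n.
have sign (e : bool) : exists2 s, resolves ks s & net s = (-1) ^+ e.
  (* Equality is impossible since the column has odd size. *)
  apply: resolve_sign => //; move: nfrc; rewrite /forced -leqNgt leq_eqVlt => /predU1P[E|//].
  by move: ks_odd; rewrite -E odd_double.
move=> v v_le; have [v0|v_gt] := leqP v (count (predC forced) kss).
  have [s Hs netE] := sign false; have [ss [Hss nets sumE]] := Hc v v0; exists (s :: ss).
  split; rewrite /= ?Hs ?Hss ?netE ?nets // big_cons sumE netE expr0; clear; lia.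
have [s Hs netE] := sign true; have [ss [Hss nets sumE]] := Hc _ (leqnn _); exists (s :: ss).
split; rewrite /= ?Hs ?Hss ?netE ?nets // big_cons sumE netE expr1; move: v_gt v_le; clear; lia.
Qed.

(** With [M] columns free and [F] forced, the bound says [F <= M + 1], so [c + M >= -1]. At -1 no
    free column is made negative; otherwise taking [v] as half of [c + M] leaves a total of 0 or
    1. *)
Lemma resolve_row kss :
  all (all (predC1 Vertex)) kss -> all (fun ks => odd (size ks)) kss ->
  all (fun ks => (fixed ks).*2 <= (size ks).+1)%N kss ->
  ((count forced kss).*2 <= (size kss).+1)%N ->
  exists ss, [/\ all2 resolves kss ss, all (fun s => `|net s| == 1) ss &
    `|\sum_(s <- ss) net s| <= 1].
Proof.
move=> kssV kss_odd kss_le F_le.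
have [c c_le Hc] := resolve_row_shifted kssV kss_odd kss_le.
have sz := count_predC forced kss.
move: Hc sz c_le F_le; set M := count (predC _) _; set F := count _ _ => Hc sz c_le.
rewrite -sz {sz} => F_le; have [pos|neg] := lerP 0 (c + M%:Z); last first.
  have [//|ss [Hss nets sumE]] := Hc 0%N.
  by exists ss; split=> //; rewrite sumE; move: c_le F_le neg; clear; lia.
have [|ss [Hss nets sumE]] := Hc (absz (c + M%:Z))./2.
  by move: c_le F_le pos; clear; lia.
by exists ss; split=> //; rewrite sumE; move: c_le F_le pos; clear; lia.
Qed.

Lemma wide_nontrivial ss :
  regular (strip_pretzel (crossings ss)) -> all (fun s => s != [::]) ss ->
  has (fun s => 2 <= `|net s|) ss -> ~ trivial_diagram (strip_pretzel (crossings ss)).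
Proof.
move=> regD nss wide.
have [net0|/allPn[s0 s0ss]] := boolP (all (fun s => net s != 0) ss).
  by apply: slope_nontrivial => //; apply: no_slope (is_pretzel_strip nss) _ _; rewrite ?wide.
rewrite negbK => /eqP net0; case/hasP: wide => s sss wide.
(* Both the wide column and the column of net twist 0 vanish modulo [r]. The bound [1 < r] ensures
   that ['Z_r] has characteristic [r]. *)
pose r := `|net s|%N; have r2 : (1 < r)%N by lia.
have netr : (net s)%:~R = 0 :> 'Z_r.
  have [->|->] : net s = r%:Z \/ net s = - r%:Z by lia.
    by rewrite -pmulrn char_Zp.
  by rewrite rmorphN /= -pmulrn char_Zp ?oppr0.
apply: (@flat_nontrivial 'Z_r) => //.
pose i := index s ss; pose j := index s0 ss.
have ni : nth [::] ss i = s by apply: nth_index.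
have nj : nth [::] ss j = s0 by apply: nth_index.
have iss : (i < size ss)%N by rewrite index_mem.
have jss : (j < size ss)%N by rewrite index_mem.
have net0r : (net s0)%:~R = 0 :> 'Z_r by rewrite net0.
have [ij|ji|ij] := ltngtP i j.
- by apply: (@split_flat_colorable _ _ i j); rewrite ?ni ?nj.
- by apply: (@split_flat_colorable _ _ j i); rewrite ?ni ?nj.
by move: wide; rewrite -ni ij nj net0.
Qed.

Local Close Scope ring_scope.

(** * Replaced precrossings, counted column by column *)

Definition unresolved (xs : seq nat) : seq (seq kind) :=
  [seq nseq x Precrossing | x <- xs].

Lemma unresolved_refines xs kss :
  all2 (all2 kind_refines) (unresolved xs) kss =
  (map size kss == xs) && all (all (predC1 Vertex)) kss.
Proof.
have E x ks : all2 kind_refines (nseq x Precrossing) ks =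
    (size ks == x) && all (predC1 Vertex) ks.
  elim: x ks => [|x IH] [|k ks] //=; rewrite IH eqSS /kind_refines /=.
  by case: k => [||b] /=; rewrite ?andbF.
elim: xs kss => [|x xs IH] [|ks kss] //=.
by rewrite E IH eqseq_cons -!andbA; do !bool_congr.
Qed.

Lemma fixed_count ks : count_mem Precrossing ks + fixed ks = size ks.
Proof. exact: count_predC. Qed.

Lemma fixed_total kss :
  count_mem Precrossing (flatten kss) + \sum_(ks <- kss) fixed ks = sumn (map size kss).
Proof.
elim: kss => [|ks kss IH] /=; first by rewrite big_nil.
by rewrite count_cat big_cons -IH -(fixed_count ks) addnACA.
Qed.

Lemma unresolved_total xs : count_mem Precrossing (flatten (unresolved xs)) = sumn xs.
Proof.
by elim: xs => //= x xs IH; rewrite count_cat IH count_nseq mul1n.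
Qed.

Lemma unresolved_fixed xs : \sum_(ks <- unresolved xs) fixed ks = 0.
Proof. by rewrite big_map big1 // => x _; rewrite /fixed count_nseq mul0n. Qed.

Lemma unresolved_sizes xs : map size (unresolved xs) = xs.
Proof.
by rewrite -map_comp -[RHS]map_id; apply: eq_map => x; rewrite /= size_nseq.
Qed.

Lemma unresolved_vertexF xs : all (all (predC1 Vertex)) (unresolved xs).
Proof. by rewrite all_map; apply/allP => x _; rewrite /= all_nseq orbT. Qed.

(** Refinements of a pretzel projection amount to kinds for the double points of each column, and
    the number of replaced precrossings is the total of [fixed]. *)
Lemma knotted_byP xs k :
  knotted_by (pretzel xs) k <->
  exists kss : seq (seq kind), [/\ map size kss = xs, all (all (predC1 Vertex)) kss,
    \sum_(ks <- kss) fixed ks = k & knotted (strip_pretzel kss)].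
Proof.
rewrite pretzel_strip; split.
  case=> Q [/strip_pretzel_refined[kss ->]].
  rewrite unresolved_refines => /andP[/eqP sz kssV].
  rewrite !precrossings_strip_pretzel unresolved_total => pre kn.
  exists kss; split=> //; apply: (@addnI (count_mem Precrossing (flatten kss))).
  by rewrite fixed_total sz.
case=> kss [sz kssV sumE kn]; exists (strip_pretzel kss).
rewrite !precrossings_strip_pretzel unresolved_total; split=> //.
  by apply: strip_pretzel_refines; rewrite unresolved_refines sz eqxx.
by rewrite -sz -fixed_total sumE.
Qed.

Lemma resolves_sizes kss ss : all2 resolves kss ss -> map size ss = map size kss.
Proof.
by elim: kss ss => [|ks kss IH] [|s ss] //= /andP[/resolves_size-> /IH->].
Qed.

(** * Knotting choices of crossings, and the parity of the entries *)

Lemma regular_resolved xs ss :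
  regular (pretzel xs) -> map size ss = xs ->
  regular (strip_pretzel (crossings ss)).
Proof.
move=> regP sz; apply: refines_regular regP; rewrite pretzel_strip.
apply: strip_pretzel_refines; rewrite unresolved_refines -sz.
elim: ss {sz} => //= s ss IH; rewrite size_map eqseq_cons eqxx /=.
case/andP: IH => -> ->; rewrite andbT; by elim: s.
Qed.

Lemma nonempty_resolved xs (ss : seq (seq bool)) :
  all (leq 1) xs -> map size ss = xs -> all (fun s => s != [::]) ss.
Proof. by move=> pos sz; move: pos; rewrite -sz all_map; apply: sub_all => -[]. Qed.

(** With [t] positive crossings fixed in the column, its net twist is at least [2 t - x >= 2] in
    every resolution. *)
Lemma knotted_by_column xs1 x xs2 :
  regular (pretzel (xs1 ++ x :: xs2)) -> all (leq 1) (xs1 ++ x :: xs2) -> 2 <= x ->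
  knotted_by (pretzel (xs1 ++ x :: xs2)) (uphalf x).+1.
Proof.
move=> regP pos x2; apply/knotted_byP.
(* Enough precrossings are available because [x >= 2]. *)
pose t := (uphalf x).+1; have tx : t <= x by rewrite /t; lia.
pose ks := nseq t (Crossing true) ++ nseq (x - t) Precrossing.
have size_ks : size ks = x by rewrite size_cat !size_nseq; lia.
exists (unresolved xs1 ++ ks :: unresolved xs2).
have sz : map size (unresolved xs1 ++ ks :: unresolved xs2) = xs1 ++ x :: xs2.
  by rewrite map_cat map_cons !unresolved_sizes size_ks.
have ksV : all (all (predC1 Vertex)) (unresolved xs1 ++ ks :: unresolved xs2).
  by rewrite all_cat /= !unresolved_vertexF /ks all_cat !all_nseq !orbT.
split=> //.
  rewrite big_cat big_cons !unresolved_fixed /fixed /ks count_cat !count_nseq /=; lia.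
move=> D /(resolution_crossings ksV)[ss -> Hss].
have ssz : map size ss = xs1 ++ x :: xs2 by rewrite (resolves_sizes Hss).
apply: wide_nontrivial.
- exact: regular_resolved regP ssz.
- exact: nonempty_resolved pos ssz.
have [ss1 [[|s ss2] [-> _ //]]] := all2_catl Hss.
case/andP=> /net_resolved_ge; rewrite size_ks /ks count_cat !count_nseq /= => s_ge _.
by rewrite has_cat /=; apply/orP; right; apply/orP; left; move: s_ge; rewrite /t; lia.
Qed.

(** With [t] single columns fixed to 1, and as long as no column is wide, the others contribute at
    least -1 each, so the total is at least [2 t - (m + size ys) >= 2]. Odd columns have nonzero net
    twist, so [no_slope] applies; a wide column is handled by [wide_nontrivial]. *)
Lemma knotted_by_row m ys :
  regular (pretzel (nseq m 1 ++ ys)) -> all odd ys -> (size ys).+1 < m ->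
  knotted_by (pretzel (nseq m 1 ++ ys)) (uphalf (m + size ys)).+1.
Proof.
move=> regP ys_odd m_gt; apply/knotted_byP.
have [t Et] : exists t, t = (uphalf (m + size ys)).+1 by eexists.
(* There are enough single columns since [m] exceeds [size ys + 1]. *)
rewrite -Et; have tm : t <= m by rewrite Et; lia.
pose top := nseq t [:: Crossing true].
pose kss := top ++ nseq (m - t) [:: Precrossing] ++ unresolved ys.
have sz : map size kss = nseq m 1 ++ ys.
  by rewrite /kss /top !map_cat !map_nseq unresolved_sizes /= catA -nseqD subnKC.
have kssV : all (all (predC1 Vertex)) kss.
  by rewrite /kss /top !all_cat !all_nseq /= unresolved_vertexF !orbT.
have all_odd : all odd (nseq m 1 ++ ys) by rewrite all_cat all_nseq orbT.
exists kss; split=> //.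
  have sum_nseq n ks : \sum_(i <- nseq n ks) fixed i = n * fixed ks.
    by elim: n => [|n IH]; rewrite ?big_nil //= big_cons IH mulSn.
  by rewrite /kss /top !big_cat /= !sum_nseq unresolved_fixed /fixed /=; lia.
move=> D /(resolution_crossings kssV)[ss -> Hss].
have ssz : map size ss = nseq m 1 ++ ys by rewrite (resolves_sizes Hss).
have regD := regular_resolved regP ssz.
have nss : all (fun s => s != [::]) ss.
  apply: nonempty_resolved ssz; apply: sub_all all_odd; by case.
have [wide|/hasPn narrow] := boolP (has (fun s => 2 <= `|net s|)%R ss).
  exact: wide_nontrivial.
apply: slope_nontrivial => //; apply: no_slope (is_pretzel_strip nss) _ _.
  apply/allP => s sss; rewrite -absz_eq0.
  have := net_parity s; rewrite (allP all_odd (size s)); first by case: absz.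
  by rewrite -ssz map_f.
apply/orP; right.
have [ss1 [ss2 [Ess Hss1 Hss2]]] := all2_catl Hss.
have size1 : size ss1 = t by rewrite -(all2_size Hss1) size_nseq.
have size2 : size ss2 = m - t + size ys.
  by rewrite -(all2_size Hss2) size_cat size_nseq size_map.
have sum1 : (\sum_(s <- ss1) net s = t%:Z)%R.
  move: Hss1; rewrite /top; clear; elim: t ss1 => [|n IH] [|s ss1] //=.
    by rewrite big_nil.
  case/andP=> + /IH E; rewrite big_cons E; case: s => [|[] [|]] //= _.
  by rewrite net_cons net_nil expr0 addr0 intS.
have sum2 : (- (size ss2)%:Z <= \sum_(s <- ss2) net s)%R.
  have : {in ss2, forall s, ~~ (2 <= `|net s|)%R}.
    by move=> s sss; apply: narrow; rewrite Ess mem_cat sss orbT.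
  elim: ss2 {Ess Hss2 size2} => [_|s ss2 IH H]; first by rewrite big_nil.
  rewrite big_cons /=; have := H s; rewrite inE eqxx -ltNge => /(_ isT).
  have := IH (fun x xs => H x (mem_behead (s := s :: ss2) xs)).
  move: (\sum_(i <- _) _)%R (net s) (size ss2) => w x k; clear; lia.
rewrite Ess big_cat /= sum1; move: sum2 Et tm; rewrite size2; clear.
move: (size ys) (\sum_(s <- ss2) net s)%R => n w. lia.
Qed.

(** In the all-positive resolution, two even columns would have net twist 0 modulo 2 and so admit a
    nonconstant flat Z/2-colouring, that is, a closed component. *)
Lemma one_even_entry xs i j :
  regular (pretzel xs) -> all (leq 1) xs -> i < j < size xs ->
  odd (nth 0 xs i) || odd (nth 0 xs j).
Proof.
move=> regP pos /andP[ij jxs]; rewrite -[_ || _]negbK negb_or.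
apply/negP => /andP[evi evj].
pose ss := [seq nseq x true | x <- xs].
have ssz : map size ss = xs.
  by rewrite -map_comp -[RHS]map_id; apply: eq_map => x; rewrite /= size_nseq.
have net_even n : ~~ odd n -> ((net (nseq n true))%:~R = 0 :> 'Z_2)%R.
  move=> /negPf evn; rewrite net_nseq expr0 mul1r -pmulrn.
  by rewrite -(odd_double_half n) evn add0n -mul2n natrM char_Zp // mul0r.
have [_ _] := regular_resolved regP ssz; apply.
apply: (@split_flat_colorable _ _ i j) => //.
- exact: nonempty_resolved pos ssz.
- by rewrite size_map.
- by rewrite (nth_map 0) ?net_even // (ltn_trans ij).
- by rewrite (nth_map 0) ?net_even.
Qed.

Lemma other_entries_odd xs1 x xs2 :
  regular (pretzel (xs1 ++ x :: xs2)) -> all (leq 1) (xs1 ++ x :: xs2) ->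
  ~~ odd x -> all odd (xs1 ++ xs2).
Proof.
move=> regP pos /negPf evx; rewrite all_cat.
have nthx : nth 0 (xs1 ++ x :: xs2) (size xs1) = x by rewrite nth_cat ltnn subnn.
apply/andP; split; apply/(all_nthP 0) => i ilt.
  have := @one_even_entry _ i (size xs1) regP pos; rewrite nthx evx orbF nth_cat ilt; apply.
  by rewrite size_cat /=; lia.
have := @one_even_entry _ (size xs1) (size xs1 + i.+1) regP pos.
have -> : nth 0 (xs1 ++ x :: xs2) (size xs1 + i.+1) = nth 0 xs2 i.
  by rewrite nth_cat ltnNge leq_addr addKn.
rewrite nthx evx; apply.
by rewrite size_cat /=; lia.
Qed.

(** * Too few fixed crossings leave a trivial resolution *)

Lemma fixed_le_size (ks : seq kind) : fixed ks <= size ks.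
Proof. exact: count_size. Qed.

Lemma fixed_le_total kss ks : ks \in kss -> fixed ks <= \sum_(c <- kss) fixed c.
Proof.
elim: kss => // c kss IH; rewrite inE big_cons => /predU1P[->|/IH]; first exact: leq_addr.
by move/leq_trans; apply; apply: leq_addl.
Qed.

Lemma forced_le_total kss : count forced kss <= \sum_(c <- kss) fixed c.
Proof.
elim: kss => [|c kss IH]; rewrite ?big_nil // big_cons /=; apply: leq_add => //.
by rewrite /forced; lia.
Qed.

Lemma map_cat_inv (T U : Type) (f : T -> U) s t1 t2 :
  map f s = t1 ++ t2 -> exists s1 s2, [/\ s = s1 ++ s2, map f s1 = t1 & map f s2 = t2].
Proof.
move=> E; exists (take (size t1) s), (drop (size t1) s); rewrite cat_take_drop.
by rewrite map_take map_drop E take_size_cat ?drop_size_cat.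
Qed.

Lemma resolvable_unknotted kss ss :
  all2 resolves kss ss -> trivial_diagram (strip_pretzel (crossings ss)) ->
  ~ knotted (strip_pretzel kss).
Proof. by move=> /crossings_resolution res triv /(_ _ res). Qed.

(** Every column can still be resolved to 1 or -1, and few enough columns are forced for the total
    to be brought to at most 1 in absolute value. *)
Lemma odd_entries_unknotted m ys k :
  regular (pretzel (nseq m 1 ++ ys)) -> all odd ys ->
  {in ys, forall y, k <= uphalf y} ->
  m <= size ys + 1 \/ k <= uphalf (m + size ys) ->
  ~ knotted_by (pretzel (nseq m 1 ++ ys)) k.
Proof.
move=> regP ys_odd k_le m_le /knotted_byP[kss [sz kssV total]].
have all_odd : all odd (map size kss) by rewrite sz all_cat all_nseq orbT.
have pos : all (leq 1) (nseq m 1 ++ ys) by rewrite -sz; apply: sub_all all_odd; case.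
have kss_size : size kss = m + size ys by rewrite -(size_map size) sz size_cat size_nseq.
rewrite all_map in all_odd.
have kss_le : all (fun ks => (fixed ks).*2 <= (size ks).+1) kss.
  suff H (ks : seq kind) : ks \in kss -> (fixed ks).*2 <= (size ks).+1 by apply/allP => ks /H.
  move=> kss_ks; have : size ks \in nseq m 1 ++ ys by rewrite -sz map_f.
  have := fixed_le_size ks.
  rewrite mem_cat mem_nseq => fixed_le /orP[/andP[_ /eqP ks1]|/k_le].
    by rewrite ks1 in fixed_le *; lia.
  by have := fixed_le_total kss_ks; rewrite total; lia.
(* Each forced column uses up a fixed crossing, which settles the case
   [k <= uphalf (m + size ys)]. *)
have F_le : (count forced kss).*2 <= (size kss).+1.
  have := forced_le_total kss; rewrite total kss_size => F_le_k.
  case: m_le => [m_le|]; last by lia.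
  have [kss1 [kss2 [Ekss sz1 sz2]]] := map_cat_inv sz.
  (* If no column of [ys] is forced, at most [m] columns are, and [m <= size ys + 1]. A forced
     column of [ys] already takes all [k] fixed crossings, so it is the only forced one. *)
  have [/hasP[ks kss2_ks frc]|] := boolP (has forced kss2); last first.
    rewrite has_count -eqn0Ngt Ekss count_cat => /eqP->.
    have := count_size forced kss1; rewrite -(size_map size) sz1 size_nseq; lia.
  have ks_ys : size ks \in ys by rewrite -sz2 map_f.
  have := k_le _ ks_ys; case/splitPr: kss2_ks Ekss sz2 => kssa kssb Ekss sz2 k_le_ks.
  have F1 := forced_le_total kss1; have Fa := forced_le_total kssa.
  have Fb := forced_le_total kssb.
  have frc_lt : size (ks : seq kind) < (fixed ks).*2 := frc.
  have n1 : 0 < size ys by rewrite -sz2 size_map size_cat /= addnS.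
  move: total; rewrite Ekss !count_cat /= !big_cat /= big_cons frc => total.
  move: frc_lt k_le_ks n1 total F1 Fa Fb; clear.
  move: (size (ks : seq kind)) (size ys) (fixed ks) => x n f.
  move: (count _ kss1) (count _ kssa) (count _ kssb) => c1 ca cb.
  move: (\sum_(_ <- kss1) _) (\sum_(_ <- kssa) _) (\sum_(_ <- kssb) _) => s1 sa sb.
  by lia.
have [ss [Hss nets sum1]] := resolve_row kssV all_odd kss_le F_le.
have ssz : map size ss = nseq m 1 ++ ys by rewrite (resolves_sizes Hss).
apply: resolvable_unknotted Hss _; apply: (@narrow_trivial ss).
- exact: regular_resolved regP ssz.
- exact/is_pretzel_strip/(nonempty_resolved pos ssz).
- by apply: sub_all nets => s /eqP ns; rewrite ns lexx -normr_eq0 ns oner_eq0.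
- exact: sum1.
Qed.

Lemma resolve_each_one kss :
  all (all (predC1 Vertex)) kss -> all (fun ks => odd (size ks)) kss ->
  all (fun ks => (fixed ks).*2 <= (size ks).+1) kss ->
  exists2 ss, all2 resolves kss ss & all (fun s => `|net s| == 1)%R ss.
Proof.
elim: kss => [_ _ _|ks kss IH] /=; first by exists [::].
case/andP=> ksV kssV /andP[ks_odd kss_odd] /andP[ks_le kss_le].
have [s Hs net1] := resolve_one ksV ks_odd ks_le.
have [ss Hss nets] := IH kssV kss_odd kss_le.
by exists (s :: ss); rewrite /= ?Hs ?net1.
Qed.

(** The even column is resolved to 0 and all others, which are odd, to 1 or -1; then the diagram
    collapses onto the even column. *)
Lemma even_entry_unknotted xs1 x xs2 k :
  regular (pretzel (xs1 ++ x :: xs2)) -> all (leq 1) (xs1 ++ x :: xs2) -> ~~ odd x ->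
  {in xs1 ++ x :: xs2, forall y, 1 < y -> k <= uphalf y} ->
  ~ knotted_by (pretzel (xs1 ++ x :: xs2)) k.
Proof.
move=> regP pos evx k_le /knotted_byP[kss [sz kssV total]].
have := other_entries_odd regP pos evx; rewrite all_cat => /andP[odd1 odd2].
have kss_le : all (fun ks => (fixed ks).*2 <= (size ks).+1) kss.
  suff H (ks : seq kind) : ks \in kss -> (fixed ks).*2 <= (size ks).+1 by apply/allP => ks /H.
  move=> kss_ks; have ks_xs : size ks \in xs1 ++ x :: xs2 by rewrite -sz map_f.
  have := fixed_le_size ks.
  have := k_le _ ks_xs; have := allP pos _ ks_xs.
  by have := fixed_le_total kss_ks; rewrite total; lia.
have [kss1 [[|ks kss2] [Ekss sz1 //= [szx sz2]]]] := map_cat_inv sz.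
move: kssV kss_le; rewrite Ekss !all_cat /=.
case/and3P=> kssV1 ksV kssV2 /and3P[kss_le1 ks_le kss_le2].
have [||s Hs net0] := resolve_zero ksV; first by rewrite szx.
  (* Since the size is even, the bound [size + 1] on an even number improves to [size]. *)
  by rewrite szx; move: ks_le evx; rewrite szx; clear; lia.
rewrite -sz1 all_map in odd1; rewrite -sz2 all_map in odd2.
have [ss1 Hss1 nets1] := resolve_each_one kssV1 odd1 kss_le1.
have [ss2 Hss2 nets2] := resolve_each_one kssV2 odd2 kss_le2.
have Hss : all2 resolves (kss1 ++ ks :: kss2) (ss1 ++ s :: ss2).
  by apply: all2_cat2 => //=; rewrite Hs.
have ssz : map size (ss1 ++ s :: ss2) = xs1 ++ x :: xs2.
  by rewrite (resolves_sizes Hss) -Ekss.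
apply: resolvable_unknotted Hss _.
apply: (@split_trivial ss1 s ss2).
- exact: regular_resolved regP ssz.
- exact/is_pretzel_strip/(nonempty_resolved pos ssz).
- exact: net0.
- rewrite all_cat; apply/andP; split; [apply: sub_all nets1 | apply: sub_all nets2];
    by move=> u /eqP nu; rewrite nu lexx -normr_eq0 nu oner_eq0.
Qed.

(** * The knotting number as a least element *)

Lemma knotting_number_eq Q v :
  knotted_by Q v -> (forall k, k < v -> ~ knotted_by Q k) ->
  knotting_number Q = Some v.
Proof.
move=> knv least; rewrite /knotting_number.
have v_le : v <= precrossings Q by have [Q' [_ -> _]] := knv; apply: leq_addl.
(* The range is cut at [v]: its first part is filtered away entirely, and the second starts with
   [v]. *)
have -> : (precrossings Q).+1 = (v + (precrossings Q - v).+1) by lia.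
rewrite iotaD filter_cat add0n /= (asboolT knv).
rewrite (eq_in_filter (a2 := pred0)) ?filter_pred0 // => k.
by rewrite mem_iota add0n => /andP[_ /least/asboolF->].
Qed.

Lemma knotting_number_infinite Q :
  (forall k, ~ knotted_by Q k) -> knotting_number Q = None.
Proof.
move=> kn; rewrite /knotting_number (eq_filter (a2 := pred0)) ?filter_pred0 //.
by move=> k; apply/asboolF/kn.
Qed.

Lemma ltn_bigmin n (F : 'I_n -> nat) d k :
  k < \big[minn/d]_(j < n) F j -> k < d /\ forall j, k < F j.
Proof.
move=> H; suff [kd kF] : k < d /\ all (fun j => k < F j) (index_enum 'I_n).
  by split=> // j; apply: (allP kF); rewrite mem_index_enum.
elim: (index_enum 'I_n) H => [|j r IH]; first by rewrite big_nil.
by rewrite big_cons leq_min => /andP[kj /IH[kd kr]]; rewrite /= kj.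
Qed.

(** [uphalf] is the half rounded up. Each minimum starts from a seed: in the third clause the value
    of the first entry, which is among the values anyway, and in the fourth the value for the whole
    row. *)
Theorem theorem13 (m n : nat) (y : n.-tuple nat)
    (y_ge2 : forall j : 'I_n, 2 <= tnth y j)
    (P := pretzel (nseq m 1 ++ y))
    (P_bouquet : two_bouquet P) :
  [/\ n = 0 -> m \in [:: 0; 1] ->
        knotting_number P = None,
      n = 0 -> 1 < m ->
        knotting_number P = Some (uphalf m).+1,
      1 <= n ->
      ((forall j : 'I_n, odd (tnth y j)) /\ m <= n + 1) \/
      (exists j : 'I_n, ~~ odd (tnth y j)) ->
        knotting_number P =
        Some (\big[minn/(uphalf (head 0 y)).+1]_(j < n) (uphalf (tnth y j)).+1) &
      1 <= n -> (forall j : 'I_n, odd (tnth y j)) -> n + 1 < m ->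
        knotting_number P =
        Some (\big[minn/(uphalf (m + n)).+1]_(j < n) (uphalf (tnth y j)).+1)].
Proof.
have regP : regular P := two_bouquet_regular P_bouquet.
have ysize : size y = n := size_tuple y.
have pos : all (leq 1) (nseq m 1 ++ y).
  rewrite all_cat all_nseq orbT; apply/all_tnthP => j.
  by apply: leq_trans (y_ge2 j).
have y_odd : (forall j, odd (tnth y j)) -> all odd y by move=> H; apply/all_tnthP.
have column j : knotted_by P (uphalf (tnth y j)).+1.
  move: (y_ge2 j) regP pos; have := mem_tnth j y; rewrite /P.
  case/splitPr=> y1 y2 ge2; rewrite catA => regP' pos'.
  exact: knotted_by_column.
have row : all odd y -> n + 1 < m -> knotted_by P (uphalf (m + n)).+1.
  by move=> yo nm; rewrite -ysize; apply: knotted_by_row => //; rewrite ysize -addn1.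
(* [minn] returns one of its arguments, so the minimum is attained. *)
have min_knotted d : knotted_by P d ->
    knotted_by P (\big[minn/d]_(j < n) (uphalf (tnth y j)).+1).
  by move=> knd; elim/big_ind: _ => // a b kna knb; rewrite /minn; case: ifP.
have below (d k : nat) : k < \big[minn/d]_(j < n) (uphalf (tnth y j)).+1 ->
    {in y, forall x, k <= uphalf x}.
  by case/ltn_bigmin=> _ kF x /tnthP[j ->]; have := kF j.
split.
- move=> n0 m01; apply: knotting_number_infinite => k.
  have y0 : val y = [::] by apply: size0nil; rewrite ysize.
  (* Without further entries the bounds on [k] are void, so no number of crossings suffices. *)
  apply: odd_entries_unknotted => //; rewrite ?y0 //; left.
  by move: m01; rewrite !inE => /orP[]/eqP->.
- move=> n0 m1; have y0 : val y = [::] by apply: size0nil; rewrite ysize.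
  have Emn : uphalf m = uphalf (m + n) by rewrite n0 addn0.
  rewrite Emn; apply: knotting_number_eq.
    by apply: row; rewrite ?y0 // n0.
  move=> k k_lt; apply: odd_entries_unknotted => //; rewrite ?y0 //.
  by right; rewrite addn0 Emn.
- move=> n1 cases; apply: knotting_number_eq.
    apply: min_knotted; have -> : head 0 y = tnth y (Ordinal n1).
      by rewrite (tnth_nth 0) nth0.
    exact: column.
  move=> k /below k_le; case: cases => [[yo mn]|[j yj]].
    by apply: odd_entries_unknotted => //; [apply: y_odd | left; rewrite ysize].
  (* The condition [1 < x] leaves out the single columns. *)
  have k_le' : {in nseq m 1 ++ y, forall x, 1 < x -> k <= uphalf x}.
    move=> x; rewrite mem_cat mem_nseq => /orP[/andP[_ /eqP->]//|xy _]; exact: k_le.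
  move: yj k_le' regP pos {k_le}; have := mem_tnth j y; rewrite /P.
  case/splitPr=> y1 y2 yj; rewrite catA => k_le' regP' pos'.
  exact: even_entry_unknotted.
- move=> n1 yo mn; apply: knotting_number_eq.
    by apply: min_knotted; apply: row => //; apply: y_odd.
  (* Being below the seed gives the bound on the number of forced columns. *)
  move=> k k_lt; have [k_le _] := ltn_bigmin k_lt.
  apply: odd_entries_unknotted => //; [exact: y_odd | exact: below k_lt|].
  by right; rewrite ysize.
Qed.
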